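(* Let $d\ge 1$ and let $g\in M^1(\mathbb{R}^d)\setminus\{0\}$. Suppose that, for some $1\le p,q\le\infty$ and some $C>0$, the estimate $$\|V_g f\|_{W(L^p,L^q)(\mathbb{R}^{2d})}\le C\,\|f\|_{W(L^p,L^q)(\mathbb{R}^d)}\qquad\text{for all } f\in\mathcal{S}(\mathbb{R}^d)$$ holds. Then $p\ge q'$ and $q\ge 2$, where $q'$ is the conjugate exponent of $q$.
   Context: STFT: $V_g f(x,\omega)=\int_{\mathbb{R}^d} f(t)\,\overline{g(t-x)}\,e^{-2\pi i\omega t}\,dt$, $(x,\omega)\in\mathbb{R}^{2d}$. $\mathcal{S}(\mathbb{R}^d)$ is the Schwartz class. Wiener amalgam space: for $1\le p,q\le\infty$, $W(L^p,L^q)(\mathbb{R}^n)$ is the space of measurable functions $f$ on $\mathbb{R}^n$ with finite norm $\|f\|_{W(L^p,L^q)}=\Big(\sum_{k\in\mathbb{Z}^n}\|f\,\chi_{k+[0,1)^n}\|_{L^p}^q\Big)^{1/q}$ (supremum over $k$ if $q=\infty$). Modulation space $M^1(\mathbb{R}^d)$: for a fixed nonzero $\gamma\in\mathcal{S}(\mathbb{R}^d)$, the space of tempered distributions $g$ with $\|g\|_{M^1}=\|V_\gamma g\|_{L^1(\mathbb{R}^{2d})}<\infty$; different $\gamma$ give equivalent norms. *)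

(* Defs.v *)
From HB Require Import structures.
From mathcomp Require Import all_boot all_order all_algebra complex.
From mathcomp Require Import all_classical all_reals all_analysis measurable_realfun.
From mathcomp Require Import ring.

Set Implicit Arguments.
Unset Strict Implicit.
Unset Printing Implicit Defensive.

Import Order.TTheory GRing.Theory Num.Theory.
Import numFieldNormedType.Exports.

Local Open Scope classical_set_scope.
Local Open Scope ring_scope.
Local Open Scope complex_scope.

(* The sigma-algebra on ['rV[T]_n] generated by the coordinates; on ['rV[R]_n]
   it is the Borel sigma-algebra. *)
Section measurable_rV.
Context {d} {T : measurableType d} (n : nat).

Let coord (i : 'I_n) (v : 'rV[T]_n) : T := v ord0 i.

Let rV_set0 : g_sigma_preimage coord set0.
Proof. exact: sigma_algebra0. Qed.

Let rV_setC A : g_sigma_preimage coord A -> g_sigma_preimage coord (~` A).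
Proof. exact: sigma_algebraC. Qed.

Let rV_bigcup (F : (set 'rV[T]_n)^nat) :
  (forall i, g_sigma_preimage coord (F i)) ->
  g_sigma_preimage coord (\bigcup_i (F i)).
Proof. exact: sigma_algebra_bigcup. Qed.

HB.instance Definition _ := Pointed.on 'rV[T]_n.
HB.instance Definition _ := @isMeasurable.Build (measure_tuple_display d)
  'rV[T]_n (g_sigma_preimage coord) rV_set0 rV_setC rV_bigcup.

Lemma measurable_rV_coord i : measurable_fun [set: 'rV[T]_n] (coord i).
Proof.
move=> _ Y mY; rewrite setTI; apply: sub_sigma_algebra => /=.
rewrite -bigcup_seq/=; exists i => /=; first by rewrite mem_index_enum.
by exists Y => //; rewrite setTI.
Qed.

Lemma measurable_rVP d1 (T1 : measurableType d1) (f : T1 -> 'rV[T]_n) :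
  measurable_fun setT f <->
  forall i, measurable_fun setT (fun x => f x ord0 i).
Proof.
split=> [mf i|mf]; first exact: (measurableT_comp (measurable_rV_coord i) mf).
move=> _ A; rewrite setTI.
pose G : set (set 'rV[T]_n) := [set B | measurable (f @^-1` B)].
suff : g_sigma_preimage coord `<=` G by exact.
apply: smallest_sub => /=.
  split => /=; first by rewrite /G/= preimage_set0.
    by move=> B GB; rewrite /G/= setTD preimage_setC; exact: measurableC.
  by move=> F GF; rewrite /G/= preimage_bigcup; exact: bigcupT_measurable.
rewrite -bigcup_seq => B [i _] [Y mY <-] /=; rewrite /G/= setTI.
by have := mf i measurableT Y mY; rewrite setTI.
Qed.
End measurable_rV.

Section lebesgue_rV.
Context {R : realType}.

Definition cons_rV n (p : measurableTypeR R * 'rV[R]_n) : 'rV[R]_n.+1 :=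
  @row_mx R 1 1 n (const_mx p.1) p.2.

Lemma cons_rV0 n p : @cons_rV n p ord0 ord0 = p.1.
Proof.
have e : @ord0 n = @lshift 1 n ord0 by apply: val_inj.
by rewrite /cons_rV e; apply: etrans (row_mxEl _ _ _ _) _; rewrite mxE.
Qed.

Lemma cons_rVS n p i : @cons_rV n p ord0 (lift ord0 i) = p.2 ord0 i.
Proof.
have e : lift (@ord0 n) i = @rshift 1 n i by apply: val_inj.
by rewrite /cons_rV e; apply: etrans (row_mxEr _ _ _ _) _.
Qed.

Lemma measurable_cons_rV n : measurable_fun setT (@cons_rV n).
Proof.
apply/measurable_rVP => i; have [j ->|->] := unliftP ord0 i.
  apply: (eq_measurable_fun (fun p : measurableTypeR R * 'rV[R]_n => p.2 ord0 (j : 'I_n))).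
    by move=> p _; rewrite cons_rVS.
  exact: (measurableT_comp (measurable_rV_coord (j : 'I_n))).
by apply: (eq_measurable_fun fst) => // p _; rewrite cons_rV0.
Qed.

Section lebesgue_rVS.
Variables (n : nat) (mu : {sigma_finite_measure set 'rV[R]_n -> \bar R}).

Definition lebesgue_rVS : set 'rV[R]_n.+1 -> \bar R :=
  pushforward (lebesgue_measure \x mu)%E (@cons_rV n).

Let lebesgue_rVS0 : lebesgue_rVS set0 = 0%E.
Proof. by rewrite /lebesgue_rVS /pushforward preimage_set0 measure0. Qed.

Let measurable_cons_preimage A : measurable A -> measurable (@cons_rV n @^-1` A).
Proof.
by move=> mA; rewrite -[X in measurable X]setTI; exact: measurable_cons_rV.
Qed.

Let lebesgue_rVS_ge0 A : (0 <= lebesgue_rVS A)%E.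
Proof. by rewrite /lebesgue_rVS /pushforward measure_ge0. Qed.

Let lebesgue_rVS_sigma_additive : semi_sigma_additive lebesgue_rVS.
Proof.
move=> F mF tF mUF; rewrite /lebesgue_rVS /pushforward preimage_bigcup.
apply: measure_semi_sigma_additive.
- by move=> k; exact: measurable_cons_preimage.
- apply/trivIsetP => /= i j _ _ ij; rewrite -preimage_setI.
  by move/trivIsetP : tF => /(_ _ _ _ _ ij) ->//; rewrite preimage_set0.
- by rewrite -preimage_bigcup; exact: measurable_cons_preimage.
Qed.

HB.instance Definition _ := isMeasure.Build _ _ _
  lebesgue_rVS lebesgue_rVS0 lebesgue_rVS_ge0 lebesgue_rVS_sigma_additive.

Let lebesgue_rVS_sigma_finite : sigma_finite setT lebesgue_rVS.
Proof.
have /sigma_finiteP[F [TF ndF Foo]] :=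
  sigma_finiteT (@lebesgue_measure R : {sigma_finite_measure set _ -> \bar R}).
have /sigma_finiteP[G [TG ndG Goo]] := sigma_finiteT mu.
pose uncons (v : 'rV[R]_n.+1) : measurableTypeR R * 'rV[R]_n :=
  (v ord0 ord0, \row_i v ord0 (lift ord0 i)).
have unconsK : cancel (@cons_rV n) uncons.
  move=> [x v]; congr (_, _); first by rewrite cons_rV0.
  by apply/rowP => i; rewrite mxE cons_rVS.
have muncons : measurable_fun setT uncons.
  apply/measurable_fun_pairP; split; first exact: measurable_rV_coord.
  apply/measurable_rVP => i.
  apply: (eq_measurable_fun (fun v : 'rV[R]_n.+1 => v ord0 (lift ord0 i))).
    by move=> v _; rewrite /= mxE.
  exact: measurable_rV_coord.
exists (fun k => uncons @^-1` (F k `*` G k)).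
  rewrite -preimage_bigcup (_ : \bigcup_k _ = setT) ?preimage_setT//.
  apply/seteqP; split=> // -[x y] _.
  have : setT x by []. rewrite TF => -[k _ Fkx].
  have : setT y by []. rewrite TG => -[l _ Gly].
  exists (maxn k l) => //; split => /=.
    by move: x Fkx; exact/subsetPset/ndF/leq_maxl.
  by move: y Gly; exact/subsetPset/ndG/leq_maxr.
move=> k; have [mF Fk] := Foo k; have [mG Gk] := Goo k; split.
  by rewrite -[X in measurable X]setTI; apply: muncons => //; exact: measurableX.
rewrite /lebesgue_rVS /pushforward -comp_preimage.
rewrite (_ : _ \o _ = id); last by apply/funext => v /=; rewrite unconsK.
by rewrite preimage_id product_measure1E// lte_mul_pinfty// ge0_fin_numE.
Qed.

HB.instance Definition _ := Measure_isSigmaFinite.Build _ _ _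
  lebesgue_rVS lebesgue_rVS_sigma_finite.
End lebesgue_rVS.

(* Lebesgue measure on R^n *)
Fixpoint lebesgue_rV n : {sigma_finite_measure set 'rV[R]_n -> \bar R} :=
  if n is m.+1 then lebesgue_rVS (lebesgue_rV m) else \d_(0 : 'rV[R]_0).

Lemma lebesgue_rV_box n (a b : 'rV[R]_n) : (forall i, a ord0 i <= b ord0 i) ->
  lebesgue_rV n [set t | forall i, a ord0 i <= t ord0 i < b ord0 i] =
  (\prod_(i < n) (b ord0 i - a ord0 i))%:E.
Proof.
elim: n a b => [|n IH] a b ab.
  rewrite big_ord0 /= diracE mem_set//=; by case.
rewrite big_ord_recl.
set P := [set t | _].
pose tl (v : 'rV[R]_n.+1) : 'rV[R]_n := \row_i v ord0 (lift ord0 i).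
pose Q := [set t : 'rV[R]_n | forall i, tl a ord0 i <= t ord0 i < tl b ord0 i].
have PE : @cons_rV n @^-1` P = `[a ord0 ord0, b ord0 ord0[%classic `*` Q.
  apply/seteqP; split => [[x v]|[x v] [/= + h] i] /=.
    move=> h; split => /=; first by have := h ord0; rewrite cons_rV0 in_itv.
    by move=> i; have := h (lift ord0 i); rewrite cons_rVS !mxE.
  rewrite in_itv /= => hx; have [j ->|->] := unliftP ord0 i.
    by have := h j; rewrite cons_rVS !mxE.
  by rewrite cons_rV0.
rewrite -[LHS]/((lebesgue_measure \x lebesgue_rV n)%E (@cons_rV n @^-1` P)) PE.
rewrite product_measure1E //; last first.
  rewrite (_ : Q = \big[setI/setT]_(i < n)
    ((fun v : 'rV[R]_n => v ord0 i) @^-1` `[tl a ord0 i, tl b ord0 i[%classic)).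
    apply: bigsetI_measurable => i _; rewrite -[X in measurable X]setTI.
    by apply: measurable_rV_coord => //; exact: measurable_itv.
  rewrite -bigcap_seq; apply/seteqP; split => [v h i _|v h i].
    by rewrite /= in_itv /=; exact: h.
  by have /= := h i (mem_index_enum i); rewrite in_itv.
rewrite IH; last by move=> i; rewrite !mxE.
rewrite EFinM.
congr (_ * _)%E; last by congr EFin; apply: eq_bigr => i _; rewrite !mxE.
apply: etrans (lebesgue_measure_itv _) _; rewrite /= lte_fin.
have := ab ord0; rewrite le_eqVlt => /orP[/eqP ->|->//].
by rewrite ltxx subrr.
Qed.
End lebesgue_rV.

Section translation.
Context {R : realType}.

Lemma measurable_addr_rV n (x : 'rV[R]_n) :
  measurable_fun setT (fun t : 'rV[R]_n => t + x).
Proof.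
apply/measurable_rVP => i.
apply: (eq_measurable_fun (fun t : 'rV[R]_n => t ord0 i + x ord0 i)).
  by move=> t _; rewrite /= mxE.
by apply: measurable_funD => //; exact: measurable_rV_coord.
Qed.

Lemma lebesgue_rV_translation n (x : 'rV[R]_n) (A : set 'rV[R]_n) :
  measurable A -> lebesgue_rV n ((fun t => t + x) @^-1` A) = lebesgue_rV n A.
Proof.
elim: n x A => [|n IH] x A mA.
  by rewrite (_ : _ @^-1` _ = A)//; apply/seteqP; split=> t /=; rewrite (thinmx0 (_ + _)) (thinmx0 t).
pose a := x ord0 ord0; pose y : 'rV[R]_n := \row_i x ord0 (lift ord0 i).
pose L : {measure set (measurableTypeR R * 'rV[R]_n)%type -> \bar R} :=
  (@lebesgue_measure R \x lebesgue_rV n)%E.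
pose s (p : measurableTypeR R * 'rV[R]_n) : measurableTypeR R * 'rV[R]_n :=
  (p.1 + a, p.2 + y).
have ms : measurable_fun setT s.
  apply/measurable_fun_pairP; split => /=.
    by apply: measurable_funD => //; exact: measurable_fst.
  exact: (measurableT_comp (measurable_addr_rV y)).
have a1 (B : set (measurableTypeR R)) : measurable B ->
    lebesgue_measure ((fun r : R => r + a) @^-1` B) = lebesgue_measure B.
  move=> mB.
  have ma : measurable_fun setT
      ((fun r : R => r + a) : measurableTypeR R -> measurableTypeR R).
    by apply: measurable_funD => //; exact: measurable_id.
  pose m : {measure set (measurableTypeR R) -> \bar R} :=
    measure_function_pushforward__canonical__measure_function_Measure
      lebesgue_measure ma.
  apply/esym/(@lebesgue_measure_unique _ m) => //= _ [[u v]] _ <-.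
  rewrite /pushforward (_ : _ @^-1` _ = `]u - a, v - a]%classic); last first.
    by apply/seteqP; split=> r /=; rewrite !in_itv/= ltrBlDr lerBrDr.
  rewrite !lebesgue_measure_itv/= !lte_fin ltrD2r.
  by case: ifPn => // _; rewrite -!EFinB opprB addrA subrK.
pose m : {measure set (measurableTypeR R * 'rV[R]_n)%type -> \bar R} :=
  measure_function_pushforward__canonical__measure_function_Measure L ms.
have mcA : measurable (@cons_rV R n @^-1` A).
  by rewrite -[X in measurable X]setTI; exact: measurable_cons_rV.
have LE X : measurable X -> L X = m X.
  apply: product_measure_unique => B C mB mC.
  rewrite /m /= /pushforward.
  rewrite (_ : s @^-1` _ = ((fun r : R => r + a) @^-1` B) `*`
      ((fun t : 'rV[R]_n => t + y) @^-1` C))//.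
  rewrite product_measure1E.
  - congr (_ * _)%E; [exact: a1|exact: IH].
  - rewrite -[X in measurable X]setTI.
    by apply: measurable_funD => //; exact: measurable_id.
  - by rewrite -[X in measurable X]setTI; exact: measurable_addr_rV.
rewrite -[RHS]/(L (@cons_rV R n @^-1` A)) (LE _ mcA).
rewrite -[LHS]/(L (@cons_rV R n @^-1` ((fun t => t + x) @^-1` A))).
congr (L _); apply/seteqP.
suff e p : cons_rV p + x = cons_rV (s p).
  by split => p /=; rewrite e.
apply/rowP => i; rewrite mxE; have [j ->|->] := unliftP ord0 i.
  by rewrite !cons_rVS /= !mxE.
by rewrite !cons_rV0.
Qed.

Section integral_translation.
Variables (n : nat) (x : 'rV[R]_n) (u : 'rV[R]_n -> R).
Hypothesis iu : (lebesgue_rV n).-integrable setT (EFin \o u).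

Let mx := @measurable_addr_rV n x.

Let mu : measurable_fun setT (EFin \o u).
Proof. by have /integrableP[] := iu. Qed.

Let m : {measure set 'rV[R]_n -> \bar R} :=
  measure_function_pushforward__canonical__measure_function_Measure
    (lebesgue_rV n) mx.

Let mE A : measurable A -> A `<=` setT -> m A = lebesgue_rV n A.
Proof. by move=> mA _; rewrite -[RHS](lebesgue_rV_translation x). Qed.

Lemma integrable_translation :
  (lebesgue_rV n).-integrable setT (EFin \o (fun t => u (t + x))).
Proof.
apply/integrableP; split; first exact: (measurableT_comp mu mx).
have /integrableP[_] := iu; apply: le_lt_trans.
rewrite -[leRHS](eq_measure_integral (lebesgue_rV n) mE).
rewrite /m ge0_integral_pushforward//=.
exact: (measurableT_comp (@abse_measurable R setT) mu).
Qed.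

Lemma Rintegral_translation :
  Rintegral (lebesgue_rV n) setT (fun t => u (t + x)) =
  Rintegral (lebesgue_rV n) setT u.
Proof.
rewrite /Rintegral -[in RHS](eq_measure_integral (lebesgue_rV n) mE) /m.
by rewrite integral_pushforward//; exact: integrable_translation.
Qed.
End integral_translation.
End translation.

Section time_frequency.
Context {R : realType} {d : nat}.
Local Notation C := R[i].
Local Notation V := 'rV[R]_d.
Local Notation Re := (@complex.Re R).
Local Notation Im := (@complex.Im R).
Local Notation cabs := ComplexField.Normc.normc.
Local Notation lebesgue := (lebesgue_rV d).
Local Notation lebesgue2 := (lebesgue \x lebesgue)%E.

(* Multi-indices are sequences of coordinates: [:: i1; ..; ik] stands for the
   derivative d_i1 .. d_ik, respectively for the monomial x_i1 .. x_ik. *)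
Definition partial (b : seq 'I_d) (u : V -> R) : V -> R :=
  foldr (fun i h x => 'D_(delta_mx ord0 i) h x) u b.

Definition smooth (u : V -> R) : Prop :=
  forall b x, differentiable (partial b u) x.

Definition cpartial b (f : V -> C) : V -> C :=
  fun x => partial b (Re \o f) x +i* partial b (Im \o f) x.

Definition monomial (a : seq 'I_d) (x : V) : R := \prod_(i <- a) x ord0 i.

Definition schwartz_seminorm a b (f : V -> C) : \bar R :=
  ereal_sup (range (fun x => (`|monomial a x| * cabs (cpartial b f x))%:E)).

Definition schwartz (f : V -> C) : Prop :=
  [/\ smooth (Re \o f), smooth (Im \o f) &
      forall a b, (schwartz_seminorm a b f < +oo)%E].

(* A tempered distribution is given by its values on Schwartz functions; the
   values of the functional elsewhere are irrelevant. *)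
Definition tempered_distribution (u : (V -> C) -> C) : Prop :=
  (forall c f h, schwartz f -> schwartz h ->
     u (fun x => c * f x + h x) = c * u f + u h) /\
  (exists (s : seq (seq 'I_d * seq 'I_d)) (M : R), forall f, schwartz f ->
     ((cabs (u f))%:E <= M%:E * \sum_(ab <- s) schwartz_seminorm ab.1 ab.2 f)%E).

Definition dot (w t : V) : R := \sum_(i < d) w ord0 i * t ord0 i.

Definition cis (r : R) : C := cos r +i* sin r.

Definition cintegral (F : V -> C) : C :=
  Rintegral lebesgue setT (Re \o F) +i* Rintegral lebesgue setT (Im \o F).

(* V_g f, at z = (x, omega) *)
Definition stft (g f : V -> C) (z : V * V) : C :=
  cintegral (fun t => f t * (g (t - z.1))^* * cis (- (2 * pi * dot z.2 t))).

(* The STFT involves the product of f and (the conjugate of) g only, so that it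
   extends to the case where one of the two is a tempered distribution u, the
   integral against u being the value of u. *)

(* V_gamma u for a Schwartz window gamma *)
Definition distribution_stft (gamma : V -> C) (u : (V -> C) -> C)
    (z : V * V) : C :=
  u (fun t => (gamma (t - z.1))^* * cis (- (2 * pi * dot z.2 t))).

(* V_u f for a Schwartz function f, after the change of variable t = s + x:
   the conjugate of the integral of u(s) conj(f(s + x)) e^(2 pi i omega (s + x)) *)
Definition stft_distribution (u : (V -> C) -> C) (f : V -> C)
    (z : V * V) : C :=
  (u (fun s => (f (s + z.1))^* * cis (2 * pi * dot z.2 (s + z.1))))^*.

Definition regular_distribution (h : V -> C) (phi : V -> C) : C :=
  cintegral (fun t => h t * phi t).

Lemma distribution_stft_regular (gamma h : V -> C) :
  distribution_stft gamma (regular_distribution h) = stft gamma h.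
Proof.
by apply/funext => z; congr cintegral; apply/funext => t; rewrite mulrA.
Qed.

Lemma cisN r : (cis r)^* = cis (- r).
Proof. by rewrite /cis/= cosN sinN. Qed.

Lemma stft_distribution_regular (h f : V -> C) (z : V * V) :
  let F t := f t * (h (t - z.1))^* * cis (- (2 * pi * dot z.2 t)) in
  lebesgue.-integrable setT (EFin \o (Re \o F)) ->
  lebesgue.-integrable setT (EFin \o (Im \o F)) ->
  stft_distribution (regular_distribution h) f z = stft h f z.
Proof.
move=> F iRe iIm; rewrite /stft -/F /stft_distribution /regular_distribution.
rewrite (_ : (fun t => h t * _) = (fun t => (F (t + z.1))^*)); last first.
  apply/funext => t; rewrite /F addrK -cisN.
  have E (a b c : C) : b * (a^* * c) = (a * b^* * c^*)^*.
    case: a b c => [a1 a2] [b1 b2] [c1 c2]; apply/eqP; rewrite eq_complex /=.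
    by apply/andP; split; apply/eqP; ring.
  exact: E.
rewrite /cintegral /=; congr (_ +i* _).
  rewrite -[RHS](Rintegral_translation z.1 iRe).
  by apply: eq_Rintegral => t _ /=; case: (F _).
rewrite -[RHS](Rintegral_translation z.1 iIm) -[LHS]mulN1r -RintegralZl//.
  by apply: eq_Rintegral => t _ /=; case: (F _) => a b /=; rewrite mulN1r opprK.
rewrite (_ : _ \o _ = EFin \o (fun t => - 1 * (Im \o F) (t + z.1))); last first.
  by apply/funext => t /=; case: (F _) => a b/=; rewrite mulN1r.
exact: (integrableZl _ _ (integrable_translation z.1 iIm)).
Qed.

(* M^1, with respect to the window gamma *)
Definition modulation_space1 (gamma : V -> C) (u : (V -> C) -> C) : Prop :=
  tempered_distribution u /\
  (Lnorm lebesgue2 1 (fun z => (cabs (distribution_stft gamma u z))%:E) < +oo)%E.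

(* The norm of W(L^p, L^q) with respect to a partition (Q k)_k of the space. *)
Definition amalgam_norm {dT} {T : measurableType dT}
    (mu : {measure set T -> \bar R}) {K : choiceType} (Q : K -> set T)
    (p q : \bar R) (f : T -> C) : \bar R :=
  let a k := Lnorm mu p (fun t => (cabs (f t) * \1_(Q k) t)%:E) in
  if q is r%:E then ((\esum_(k in [set: K]) a k `^ r) `^ r^-1)%E
  else ereal_sup (range a).

Definition cube (k : 'rV[int]_d) : set V :=
  [set t | forall i, (k ord0 i)%:~R <= t ord0 i < (k ord0 i)%:~R + 1].

Definition wiener_norm (p q : \bar R) (f : V -> C) : \bar R :=
  amalgam_norm lebesgue cube p q f.

(* R^2d = R^d x R^d, whose unit cubes are the products of unit cubes of R^d *)
Definition wiener_norm2 (p q : \bar R) (F : V * V -> C) : \bar R :=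
  amalgam_norm lebesgue2
    (fun k : 'rV[int]_d * 'rV[int]_d => cube k.1 `*` cube k.2) p q F.

End time_frequency.

(* Main.v *)
Require Import Defs.
From HB Require Import structures.
From mathcomp Require Import all_boot all_order all_algebra complex.
From mathcomp Require Import all_classical all_reals all_analysis measurable_realfun ess_sup_inf.
From mathcomp Require Import ring lra.

Set Implicit Arguments.
Unset Strict Implicit.
Unset Printing Implicit Defensive.

Import Order.TTheory GRing.Theory Num.Theory.
Import numFieldNormedType.Exports.

Local Open Scope classical_set_scope.
Local Open Scope ring_scope.

(* Let [u] be the window.  If [u(psi) <> 0], then [F = V_u phi], [phi] the
   conjugate of [psi], is continuous with [F(0, 0) <> 0], and the estimate applied
   to [phi] puts [F] in [W(L^p, L^q)]; for [q < oo], [F] is therefore small in mean on far cubes.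
   For a trigonometric polynomial [P(s) = sum_(k < N) c_k e^(2 pi i k s)] and
   [f(t) = phi(t) P(L t_1)], [V_u f] is the sum of the translates of [c_k F] by
   [k L e_1] in the frequency variable, which become independent of each other
   as [L] grows: [|V_u f|_W(L^p, L^q)] is at least a constant times [m^(1/q)],
   [m] being the number of [k] with [|c_k| >= 1/2].  Two choices of [P] give the
   two conditions: for Rudin-Shapiro polynomials [|P| <= sqrt (2 N)] and
   [|c_k| = 1], hence [1/q <= 1/2]; for the Fejer kernel [|P| <= N] and [|P|] has
   mean 1, so that [|f|_W(L^p, L^q)] is at most a constant times [N^(1 - 1/p)],
   hence [1/q <= 1 - 1/p]. *)

(** * Real Schwartz functions *)

Section schwartz_real.
Context {R : realType} {d : nat}.
Local Notation V := 'rV[R]_d.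
Implicit Types (v : V -> R) (x w s t z : V).

(** The window is only a functional on Schwartz functions, so nothing about V_u f can be read off an
    integral: its continuity, and with it measurability and the lower bound near the origin, must
    come from the seminorm estimate for [u]. This is why time-frequency shifts are bounded and
    compared in weighted norms, uniformly in their parameters. The lower bounds use only means over
    cubes: on a set of measure one Hoelder bounds the mean by every L^p norm, and unwanted
    translates can be subtracted from it. Translations are integral in order to carry cubes to
    cubes. The spacing [L] depends on the polynomial, so the upper bounds for f must not depend on
    [L]. They do not: dilation by a positive integer changes neither the supremum of |P| nor its
    mean over a unit interval. The number of terms can then grow along the powers of 2, the lengths
    of the Rudin-Shapiro polynomials, which compares the exponents. *)

Lemma norm_coord_le x i : `|x ord0 i| <= `|x|.
Proof.
rewrite [leRHS](@mx_normrE R 1 d x).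
exact: (@le_bigmax _ _ _ _ (fun ij : 'I_1 * 'I_d => `|x ij.1 ij.2|) (ord0, i)).
Qed.

Lemma dot_le w t : `|dot w t| <= d%:R * `|w| * `|t|.
Proof.
apply: le_trans (ler_norm_sum _ _ _) _.
rewrite -mulrA mulr_natl -[X in _ *+ X](card_ord d) -sumr_const.
by apply: ler_sum => i _; rewrite normrM ler_pM// norm_coord_le.
Qed.

Lemma dotDl w w' t : dot (w + w') t = dot w t + dot w' t.
Proof.
by rewrite /dot -big_split; apply: eq_bigr => i _; rewrite mxE mulrDl.
Qed.

Lemma dotDr w t t' : dot w (t + t') = dot w t + dot w t'.
Proof.
by rewrite /dot -big_split; apply: eq_bigr => i _; rewrite mxE mulrDr.
Qed.

Lemma dotNl w t : dot (- w) t = - dot w t.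
Proof. by rewrite /dot -sumrN; apply: eq_bigr => i _; rewrite mxE mulNr. Qed.

Lemma dotNr w t : dot w (- t) = - dot w t.
Proof. by rewrite /dot -sumrN; apply: eq_bigr => i _; rewrite mxE mulrN. Qed.

Lemma cos_lipschitz (a b : R) : `|cos a - cos b| <= `|a - b|.
Proof.
wlog ab : a b / a <= b.
  move=> H; case: (leP a b) => [/H//|/ltW/H].
  by rewrite distrC (distrC b).
rewrite distrC.
have [|c _ ->] := @MVT_segment R cos (fun c => - sin c) a b ab
    (fun c _ => is_derive_cos c).
  by apply: continuous_subspaceT; exact: continuous_cos.
by rewrite (distrC a) normrM normrN ler_piMl// sin_max.
Qed.

Lemma differentiable_dot w x : differentiable (dot w) x.
Proof.
rewrite (_ : dot w = \sum_(i < d) (w ord0 i *: (fun t : V => t ord0 i : R))).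
  apply: differentiable_sum => i.
  exact: (@differentiableZ R V R _ _ _ (@differentiable_coord R 1 d x ord0 i)).
by apply/funext => t; rewrite fct_sumE.
Qed.

Lemma derive_line v x h (t : R) : 'D_1 (fun r : R => v (x + r *: h)) t = 'D_h v (x + t *: h).
Proof.
apply: (congr1 (fun f : R -> R => lim (f @ 0^'))); apply/funext => r /=.
by rewrite -[r *: 1]/(r * 1) mulr1 scalerDl addrCA.
Qed.

Lemma derivable_line v x h (t : R) : derivable v (x + t *: h) h ->
  derivable (fun r : R => v (x + r *: h)) t 1.
Proof.
have E (f g : R -> R) : f = g -> cvg (f @ 0^') -> cvg (g @ 0^') by move->.
apply: E; apply/funext => r /=.
by rewrite -[r *: 1]/(r * 1) mulr1 scalerDl addrCA.
Qed.

Lemma derive_coords v x h : differentiable v x ->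
  'D_h v x = \sum_(i < d) h ord0 i * 'D_(delta_mx ord0 i) v x.
Proof.
move=> dv; rewrite deriveE//.
rewrite [in LHS](row_sum_delta h) linear_sum; apply: eq_bigr => i _.
by rewrite linearZ deriveE.
Qed.

Lemma mean_value v x y : (forall z, differentiable v z) ->
  exists2 t : R, 0 <= t <= 1 &
    v y - v x = \sum_(i < d) (y - x) ord0 i * 'D_(delta_mx ord0 i) v (x + t *: (y - x)).
Proof.
move=> dv; pose g (r : R) : R := v (x + r *: (y - x)).
have dg (r : R) : is_derive r 1 g ('D_(y - x) v (x + r *: (y - x))).
  apply: DeriveDef; first exact/derivable_line/diff_derivable.
  exact: derive_line.
have [|t] := @MVT_segment R g _ 0 1 ler01 (fun (r : R) _ => dg r).
  apply: continuous_subspaceT => r; apply: differentiable_continuous.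
  by apply/derivable1_diffP; apply: ex_derive.
rewrite in_itv/= => t01; rewrite /g scale1r scale0r addr0 subrKC subr0 mulr1.
move=> ->; exists t => //; exact: derive_coords.
Qed.

(** Powers of 1 + |s| replace the monomials of [schwartz_seminorm] because this weight is
    submultiplicative and so behaves well under translations; [monomial_le] and [monomial_ge]
    compare the two. *)
Definition rapid (h : V -> R) :=
  forall n, exists M : R, forall s, (1 + `|s|) ^+ n * `|h s| <= M.

Definition rschwartz v :=
  smooth v /\ forall b, rapid (partial b v).

Lemma partial_cat a b v : partial (a ++ b) v = partial a (partial b v).
Proof. by rewrite /partial foldr_cat. Qed.

Lemma rschwartz_partial v b : rschwartz v -> rschwartz (partial b v).
Proof.
by move=> [sv rv]; split=> [a x|a]; rewrite -partial_cat; [exact: sv|exact: rv].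
Qed.

Lemma rschwartz_derive v i : rschwartz v ->
  rschwartz (fun x => 'D_(delta_mx ord0 i) v x).
Proof. exact: (@rschwartz_partial v [:: i]). Qed.

Lemma rschwartz_diff v x : rschwartz v -> differentiable v x.
Proof. by move=> [sv _]; exact: (sv [::]). Qed.

Lemma rschwartz_rapid v : rschwartz v -> rapid v.
Proof. by move=> [_ rv]; exact: (rv [::]). Qed.

Lemma rapid_ge0 h n : rapid h ->
  exists2 M : R, 0 <= M & forall s, (1 + `|s|) ^+ n * `|h s| <= M.
Proof.
move=> /(_ n)[M hM]; exists `|M| => // s; apply: le_trans (hM s) _.
exact: ler_norm.
Qed.

(** Peetre's inequality with exponent one; it makes the weights at two points at bounded distance
    comparable. *)
Lemma weight_le s t : 1 + `|s| <= (1 + `|s - t|) * (1 + `|t|).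
Proof.
have := ler_normD (s - t) t; rewrite subrK => H.
have := normr_ge0 (s - t); have := normr_ge0 t; nra.
Qed.

Lemma weight_le_exp n s t (rho : R) : `|s - t| <= rho ->
  (1 + `|s|) ^+ n <= (1 + rho) ^+ n * (1 + `|t|) ^+ n.
Proof.
move=> st; rewrite -exprMn lerXn2r ?nnegrE ?mulr_ge0 ?addr_ge0//.
  exact: le_trans (normr_ge0 _) st.
by apply: le_trans (weight_le s t) _; rewrite ler_pM// ?addr_ge0// lerD2l.
Qed.

Lemma monomial_le (a : seq 'I_d) s : `|monomial a s| <= (1 + `|s|) ^+ size a.
Proof.
rewrite /monomial; elim: a => [|i a IH]; first by rewrite big_nil normr1.
rewrite big_cons normrM exprS ler_pM//.
by apply: le_trans (norm_coord_le _ _) _; rewrite lerDr.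
Qed.

(** The norm is the maximum of the coordinates, so |s|^n is up to sign one of the
    [monomial (nseq n i) s]; when |s| <= 1 the constant term is enough. *)
Lemma monomial_ge n s :
  (1 + `|s|) ^+ n <= 2 ^+ n * (1 + \sum_(i < d) `|monomial (nseq n i) s|).
Proof.
have S0 : 0 <= \sum_(i < d) `|monomial (nseq n i) s| by exact: sumr_ge0.
have mE i : `|monomial (nseq n i) s| = `|s ord0 i| ^+ n.
  rewrite /monomial; elim: (n) => [|m IH]; first by rewrite big_nil normr1.
  by rewrite big_cons normrM exprS IH.
have [s1|s1] := leP `|s| 1.
  apply: le_trans (_ : 2 ^+ n * 1 <= _); last by rewrite ler_wpM2l ?lerDl.
  by rewrite mulr1 lerXn2r ?nnegrE ?addr_ge0//; lra.
have [i si] : exists i, `|s| = `|s ord0 i|.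
  have : mx_norm s != 0 by rewrite gt_eqF//; exact: lt_trans s1.
  by move=> /mx_norm_neq0[[a i] /=]; rewrite ord1 => h; exists i.
apply: le_trans (_ : 2 ^+ n * `|s| ^+ n <= _).
  rewrite -exprMn lerXn2r ?nnegrE ?addr_ge0 ?mulr_ge0//; lra.
rewrite ler_wpM2l// si -mE (bigD1 i)//= addrCA lerDl.
by rewrite addr_ge0// sumr_ge0.
Qed.

End schwartz_real.

(** * Time-frequency shifts of Schwartz functions *)

Section time_frequency_family.
Context {R : realType} {d : nat}.
Local Notation V := 'rV[R]_d.
Local Notation e_ i := (delta_mx ord0 i : 'rV[R]_d).
Implicit Types (v : V -> R) (x w s t z : V) (h k : V -> V -> V -> R).

(* The families [h x w] spanned by the time-frequency shifts of Schwartz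
   functions, with coefficients polynomial in [w]: a class that contains the
   functions of interest and is stable under the partial derivatives in the
   last variable. *)
Inductive tf_family : (V -> V -> V -> R) -> Prop :=
| tf_atom v (c : R) : rschwartz v ->
    tf_family (fun x w s => v (s + x) * cos (2 * pi * dot w (s + x) + c))
| tf_add h k : tf_family h -> tf_family k ->
    tf_family (fun x w s => h x w s + k x w s)
| tf_scale (a : R) h : tf_family h -> tf_family (fun x w s => a * h x w s)
| tf_coord i h : tf_family h -> tf_family (fun x w s => w ord0 i * h x w s).

Lemma differentiable_shift v x s :
  differentiable v (s + x) -> differentiable (fun t => v (t + x)) s.
Proof.
by move=> dv; apply: (@differentiable_comp _ _ _ _ (fun t : V => t + x) v) => //.
Qed.

Lemma derive_translate v x s i :
  'D_(e_ i) (fun t => v (t + x)) s = 'D_(e_ i) v (s + x).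
Proof.
apply: (congr1 (fun f : R -> R => lim (f @ 0^'))); apply/funext => r /=.
by rewrite addrA.
Qed.

Let wave x w (c : R) s := cos (2 * pi * dot w (s + x) + c).

Lemma dot_delta w i : dot w (e_ i) = w ord0 i.
Proof.
rewrite /dot (bigD1 i)//= mxE !eqxx mulr1 big1 ?addr0// => j ji.
by rewrite mxE (negbTE ji) andbF mulr0.
Qed.

Lemma dotZr w (a : R) t : dot w (a *: t) = a * dot w t.
Proof.
by rewrite /dot mulr_sumr; apply: eq_bigr => i _; rewrite mxE mulrCA.
Qed.

Lemma differentiable_wave x w c s : differentiable (wave x w c) s.
Proof.
apply: (@differentiable_comp _ _ _ _ (fun t => 2 * pi * dot w (t + x) + c) cos).
  apply: differentiableD => //.
  apply: (@differentiableZ R V R _ (2 * pi)).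
  by apply: differentiable_shift; exact: differentiable_dot.
apply/derivable1_diffP; exact: derivable_cos.
Qed.

(** A derivative only moves the phase [c] by a quarter turn. A free phase thus makes a single type
    of atom sufficient, without sines. *)
Lemma derive_wave x w c s i :
  'D_(e_ i) (wave x w c) s = 2 * pi * w ord0 i * wave x w (c + pi / 2) s.
Proof.
have := derive_line (wave x w c) s (e_ i) 0; rewrite scale0r addr0 => <-.
have -> : (fun r : R => wave x w c (s + r *: e_ i)) =
    cos \o (fun r : R => r * (2 * pi * w ord0 i) + (2 * pi * dot w (s + x) + c)).
  apply/funext => r; rewrite /wave /=; congr cos.
  by rewrite (addrAC s) (dotDr w (s + x)) dotZr dot_delta; ring.
rewrite -derive1E derive1_comp//.
rewrite [X in _ * X](_ : _ = 2 * pi * w ord0 i).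
  rewrite derive1E derive_val mul0r add0r /wave (addrA _ c) cosDpihalf mulrC.
  by [].
rewrite derive1E deriveD// derive_cst addr0.
by rewrite deriveMr// derive_id mulr1.
Qed.

(** Differentiability is carried along in the induction because the rules for derivatives of sums
    and multiples require it of the components. *)
Lemma tf_derive h i : tf_family h -> (forall x w s, differentiable (h x w) s) /\
  (exists2 k, tf_family k &
    forall x w, (fun s => 'D_(e_ i) (h x w) s) = k x w).
Proof.
elim=> [v c Sv|{}h k _ [dh [h' Fh hE]] _ [dk [k' Fk kE]]|
    a {}h _ [dh [h' Fh hE]]|j {}h _ [dh [h' Fh hE]]].
- have dv x s : differentiable (fun t => v (t + x)) s.
    exact/differentiable_shift/rschwartz_diff.
  split=> [x w s|].
    exact: (differentiableM (dv x s) (differentiable_wave x w c s)).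
  have := tf_add (tf_atom c (rschwartz_derive i Sv))
    (tf_coord i (tf_scale (2 * pi) (tf_atom (c + pi / 2) Sv))).
  set k := (X in tf_family X) => Fk; exists k => // x w; apply/funext => s.
  have -> : (fun s => v (s + x) * cos (2 * pi * dot w (s + x) + c)) =
    (fun t => v (t + x)) * wave x w c by [].
  rewrite deriveM; try exact: diff_derivable; last first.
    exact/diff_derivable/differentiable_wave.
  rewrite derive_wave derive_translate /k /wave -![_ *: _]/(_ * _).
  by ring.
- split=> [x w s|]; first exact: (differentiableD (dh x w s) (dk x w s)).
  exists (fun x w s => h' x w s + k' x w s); first exact: tf_add.
  move=> x w; apply/funext => s.
  rewrite (_ : (fun s => _) = h x w + k x w)//.
  by rewrite deriveD; [rewrite -hE -kE|exact: diff_derivable..].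
- split=> [x w s|]; first exact: (@differentiableZ _ _ _ _ a _ (dh x w s)).
  exists (fun x w s => a * h' x w s); first exact: tf_scale.
  move=> x w; apply/funext => s.
  rewrite (_ : (fun s => _) = a *: h x w)//.
  by rewrite deriveZ; [rewrite -hE|exact: diff_derivable].
- split=> [x w s|].
    exact: (@differentiableZ _ _ _ _ (w ord0 j) _ (dh x w s)).
  exists (fun x w s => w ord0 j * h' x w s); first exact: tf_coord.
  move=> x w; apply/funext => s.
  rewrite (_ : (fun s => _) = w ord0 j *: h x w)//.
  by rewrite deriveZ; [rewrite -hE|exact: diff_derivable].
Qed.

Lemma tf_partial h b : tf_family h ->
  exists2 k, tf_family k & forall x w, partial b (h x w) = k x w.
Proof.
elim: b => [|i b IH] Fh; first by exists h.
have [k Fk kE] := IH Fh; have [_ [k' Fk' k'E]] := tf_derive i Fk.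
by exists k' => // x w; rewrite -k'E /= -kE.
Qed.

Lemma tf_smooth h x w : (0 < d)%N -> tf_family h -> smooth (h x w).
Proof.
move=> d0 Fh b s; have [k Fk ->] := tf_partial b Fh.
(* [tf_derive] takes a direction even for its differentiability part; [0 < d] provides one. *)
by have [dk _] := tf_derive (Ordinal d0) Fk; exact: dk.
Qed.

Lemma tf_bound h n (rho : R) : tf_family h -> exists2 M : R, 0 <= M &
  forall x w s, `|x| <= rho -> `|w| <= rho -> (1 + `|s|) ^+ n * `|h x w s| <= M.
Proof.
elim=> [v c Sv|{}h k _ [M M0 hM] _ [N N0 kN]|a {}h _ [M M0 hM]|j {}h _ [M M0 hM]].
- have [M M0 vM] := rapid_ge0 n (rschwartz_rapid Sv).
  (* [rho] may be negative, in which case the bound is vacuous; the absolute value keeps the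
     constant nonnegative. *)
  exists (`|(1 + rho) ^+ n * M|) => // x w s xr _.
  have r0 : 0 <= rho := le_trans (normr_ge0 _) xr.
  apply: le_trans (ler_norm _); rewrite normrM.
  apply: le_trans (_ : (1 + `|s|) ^+ n * `|v (s + x)| <= _).
    by rewrite ler_wpM2l ?exprn_ge0 ?addr_ge0// ler_piMr// cos_max.
  apply: le_trans (_ : (1 + rho) ^+ n * ((1 + `|s + x|) ^+ n * `|v (s + x)|) <= _).
    rewrite mulrA ler_wpM2r// weight_le_exp// opprD addrA subrr sub0r normrN//.
  by rewrite ler_wpM2l ?exprn_ge0 ?addr_ge0.
- exists (M + N); rewrite ?addr_ge0// => x w s xr wr.
  apply: le_trans (lerD (hM x w s xr wr) (kN x w s xr wr)).
  by rewrite -mulrDr ler_wpM2l ?exprn_ge0 ?addr_ge0// ler_normD.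
- exists (`|a| * M); rewrite ?mulr_ge0// => x w s xr wr.
  by rewrite normrM mulrCA ler_wpM2l// hM.
- exists (`|rho| * M); rewrite ?mulr_ge0// => x w s xr wr.
  rewrite normrM mulrCA ler_pM ?mulr_ge0 ?exprn_ge0 ?addr_ge0 ?hM//.
  exact: le_trans (norm_coord_le _ _) (le_trans wr (ler_norm _)).
Qed.

(** Mean value theorem on the segment: the intermediate point stays within [rho] of [s], so the
    weights at the two points are comparable and the decay of the gradient there counts as decay at
    [s]. *)
Lemma rschwartz_lipschitz v n (rho : R) : rschwartz v -> exists2 M : R, 0 <= M &
  forall s t, `|s - t| <= rho ->
    (1 + `|s|) ^+ n * `|v s - v t| <= M * `|s - t|.
Proof.
move=> Sv.
have /choice[f fP] : forall i, exists M, 0 <= M /\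
    forall s, (1 + `|s|) ^+ n * `|'D_(e_ i) v s| <= M.
  move=> i.
  have [M M0 vM] := rapid_ge0 n (rschwartz_rapid (rschwartz_derive i Sv)).
  by exists M.
have f0 i : 0 <= f i by have [] := fP i.
exists (`|1 + rho| ^+ n * \sum_(i < d) f i).
  by rewrite mulr_ge0 ?exprn_ge0// sumr_ge0.
move=> s t st; have r0 : 0 <= rho := le_trans (normr_ge0 _) st.
have [a /andP[a0 a1] ->] := mean_value t s (fun z => rschwartz_diff z Sv).
set y := t + _.
have sy : `|s - y| <= rho.
  rewrite /y (_ : s - _ = (1 - a) *: (s - t)); last first.
    by rewrite scalerBl scale1r opprD addrA.
  by rewrite normrZ (le_trans _ st)// ler_piMl// ger0_norm ?subr_ge0// gerBl.
apply: le_trans (_ : (1 + rho) ^+ n * (1 + `|y|) ^+ n *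
    (\sum_(i < d) `|s - t| * `|'D_(e_ i) v y|) <= _).
  rewrite ler_pM ?exprn_ge0 ?addr_ge0 ?weight_le_exp//.
  apply: le_trans (ler_norm_sum _ _ _) _; apply: ler_sum => i _.
  by rewrite normrM ler_wpM2r// norm_coord_le.
rewrite -mulr_sumr ger0_norm ?addr_ge0// -!mulrA ler_wpM2l ?exprn_ge0 ?addr_ge0//.
rewrite mulrCA mulrC ler_wpM2r// mulr_sumr; apply: ler_sum => i _.
by have [_] := fP i; exact.
Qed.

(** The phase 2 pi w.(s + x) is not Lipschitz in [w] uniformly in [s]: its variation grows like 1 +
    |s + x|. The rapid decay of the Schwartz factor pays for this growth. *)
Lemma tf_lipschitz h n (rho : R) : tf_family h -> exists2 M : R, 0 <= M &
  forall x w x' w' s, `|x| <= rho -> `|w| <= rho -> `|x'| <= rho -> `|w'| <= rho ->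
    (1 + `|s|) ^+ n * `|h x w s - h x' w' s| <= M * (`|x - x'| + `|w - w'|).
Proof.
move=> Fh; elim: Fh rho => [v c Sv|{}h k _ IHh _ IHk|a {}h _ IHh|j {}h Fh IHh] rho.
- have [M M0 vM] := rschwartz_lipschitz n (rho + rho) Sv.
  (* One power more than [n]: it absorbs the factor 1 + |y| in the variation of the phase. *)
  have [N N0 vN] := rapid_ge0 n.+1 (rschwartz_rapid Sv).
  pose r := `|1 + rho| ^+ n; have r0 : 0 <= r by rewrite exprn_ge0.
  have [K K0 KE] : exists2 K : R, 0 <= K & K = 2 * pi * d%:R.
    by exists (2 * pi * d%:R); rewrite ?mulr_ge0 ?pi_ge0.
  exists (r * M + r * (N * (K * (1 + `|rho|)))).
    by rewrite addr_ge0 ?mulr_ge0 ?addr_ge0.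
  move=> x w x' w' s xr wr x'r w'r.
  have rho0 : 0 <= rho := le_trans (normr_ge0 _) xr.
  set y := s + x; set y' := s + x'; set th := _ + c; set th' := _ + c.
  have yy : y - y' = x - x' by rewrite /y /y' opprD addrACA subrr add0r.
  have xx : `|x - x'| <= rho + rho.
    by apply: le_trans (ler_normB _ _) _; exact: lerD.
  have rE : r = (1 + rho) ^+ n by rewrite /r ger0_norm ?addr_ge0.
  have sy : (1 + `|s|) ^+ n <= r * (1 + `|y|) ^+ n.
    by rewrite rE weight_le_exp// /y opprD addrA subrr sub0r normrN.
  have -> : v y * cos th - v y' * cos th' =
      (v y - v y') * cos th' + v y * (cos th - cos th') by ring.
  have A : (1 + `|s|) ^+ n * `|(v y - v y') * cos th'| <=
      r * M * (`|x - x'| + `|w - w'|).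
    apply: le_trans (_ : r * M * `|x - x'| <= _); last first.
      by rewrite ler_wpM2l ?mulr_ge0// lerDl.
    apply: le_trans (_ : r * ((1 + `|y|) ^+ n * `|v y - v y'|) <= _).
      rewrite mulrA ler_pM ?exprn_ge0 ?addr_ge0// normrM ler_piMr//.
      exact: cos_max.
    by rewrite -mulrA ler_wpM2l// -yy vM// yy.
  have thth : `|th - th'| <= K * (1 + `|rho|) * (1 + `|y|) * (`|x - x'| + `|w - w'|).
    have -> : th - th' = 2 * pi * (dot (w - w') y + dot w' (y - y')).
      by rewrite /th /th' dotDl dotNl dotDr dotNr; ring.
    rewrite yy normrM ger0_norm ?mulr_ge0 ?pi_ge0//.
    have B1 := dot_le (w - w') y; have B2 := dot_le w' (x - x').
    rewrite KE -!mulrA ler_wpM2l// ler_wpM2l ?pi_ge0//.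
    apply: le_trans (ler_normD _ _) _.
    apply: le_trans (lerD B1 B2) _; rewrite -!mulrA -mulrDr ler_wpM2l//.
    rewrite (ger0_norm rho0).
    have := normr_ge0 y; have := normr_ge0 (x - x'); have := normr_ge0 (w - w').
    have := normr_ge0 w'; move: w'r.
    move: `|y| `|x - x'| `|w - w'| `|w'| => Y X W W' W'r W'0 W0 X0 Y0.
    rewrite (_ : (1 + rho) * _ = W * Y + W + (1 + rho) * X * (1 + Y) + rho * W * (1 + Y)); last by ring.
    have := mulr_ge0 X0 Y0; have := mulr_ge0 W0 Y0; nra.
  have B : (1 + `|s|) ^+ n * `|v y * (cos th - cos th')| <=
      r * (N * (K * (1 + `|rho|))) * (`|x - x'| + `|w - w'|).
    apply: le_trans (_ : r * (1 + `|y|) ^+ n * (`|v y| *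
        (K * (1 + `|rho|) * (1 + `|y|) * (`|x - x'| + `|w - w'|))) <= _).
      rewrite ler_pM ?exprn_ge0 ?addr_ge0// normrM ler_wpM2l//.
      exact: le_trans (cos_lipschitz _ _) thth.
    rewrite (_ : _ * (_ * _) = r * ((1 + `|y|) ^+ n.+1 * `|v y| * (K * (1 + `|rho|))) *
      (`|x - x'| + `|w - w'|)); last by rewrite exprS; ring.
    rewrite ler_wpM2r ?addr_ge0// ler_wpM2l// ler_wpM2r ?mulr_ge0 ?addr_ge0//.
  rewrite [leRHS]mulrDl; apply: le_trans (lerD A B).
  rewrite -mulrDr ler_wpM2l ?exprn_ge0 ?addr_ge0//.
  exact: ler_normD.
- have [M M0 hM] := IHh rho; have [N N0 kN] := IHk rho.
  exists (M + N); rewrite ?addr_ge0// => x w x' w' s xr wr x'r w'r.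
  rewrite mulrDl; apply: le_trans (lerD (hM _ _ _ _ s xr wr x'r w'r)
    (kN _ _ _ _ s xr wr x'r w'r)).
  rewrite opprD addrACA -mulrDr ler_wpM2l ?exprn_ge0 ?addr_ge0//.
  exact: ler_normD.
- have [M M0 hM] := IHh rho.
  exists (`|a| * M); rewrite ?mulr_ge0// => x w x' w' s xr wr x'r w'r.
  by rewrite -mulrBr normrM mulrCA -mulrA ler_wpM2l// hM.
- have [M M0 hM] := IHh rho; have [N N0 hN] := tf_bound n rho Fh.
  exists (`|rho| * M + N); rewrite ?addr_ge0 ?mulr_ge0// => x w x' w' s xr wr x'r w'r.
  have -> : w ord0 j * h x w s - w' ord0 j * h x' w' s =
    w ord0 j * (h x w s - h x' w' s) + (w - w') ord0 j * h x' w' s.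
    by rewrite !mxE; ring.
  have A : (1 + `|s|) ^+ n * `|w ord0 j * (h x w s - h x' w' s)| <=
      `|rho| * M * (`|x - x'| + `|w - w'|).
    rewrite normrM mulrCA -mulrA ler_pM ?mulr_ge0 ?exprn_ge0 ?addr_ge0 ?hM//.
    exact: le_trans (norm_coord_le _ _) (le_trans wr (ler_norm _)).
  have B : (1 + `|s|) ^+ n * `|(w - w') ord0 j * h x' w' s| <=
      N * (`|x - x'| + `|w - w'|).
    rewrite normrM mulrCA mulrC ler_pM ?mulr_ge0 ?exprn_ge0 ?addr_ge0 ?hN//.
    by apply: le_trans (norm_coord_le _ _) _; rewrite lerDr.
  rewrite [leRHS]mulrDl; apply: le_trans (lerD A B).
  by rewrite -mulrDr ler_wpM2l ?exprn_ge0 ?addr_ge0// ler_normD.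
Qed.

End time_frequency_family.

(** * Tempered distributions *)

Section complex_modulus.
Context {R : realType}.
Local Open Scope complex_scope.
Local Notation cabs := (@ComplexField.Normc.normc R).
Implicit Types (z : R[i]) (a b r : R).

Lemma cabs_ge0 z : 0 <= cabs z.
Proof. by case: z => a b; exact: sqrtr_ge0. Qed.

Lemma cabsD z z' : cabs (z + z') <= cabs z + cabs z'.
Proof. exact: (@le_normcD R z z'). Qed.

Lemma cabsN z : cabs (- z) = cabs z.
Proof. exact: (@normcN R z). Qed.

Lemma cabsB z z' : cabs (z - z') = cabs (z' - z).
Proof. by rewrite -cabsN opprB. Qed.

Lemma cabs_sum (I : Type) (s : seq I) (P : pred I) (F : I -> R[i]) :
  cabs (\sum_(i <- s | P i) F i) <= \sum_(i <- s | P i) cabs (F i).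
Proof.
apply: (big_ind2 (fun x y => cabs x <= y)) => //; first by rewrite ComplexField.Normc.normc0.
by move=> x1 x2 y1 y2 H1 H2; apply: le_trans (cabsD _ _) _; exact: lerD.
Qed.

Lemma cabs_real a : cabs a%:C = `|a|.
Proof. by rewrite /= expr0n addr0 sqrtr_sqr. Qed.

Lemma cabsJ z : cabs z^* = cabs z.
Proof. by case: z => a b /=; rewrite sqrrN. Qed.

Lemma cabs_le a b : cabs (a +i* b) <= `|a| + `|b|.
Proof.
rewrite /= -[leRHS]ger0_norm ?addr_ge0// -sqrtr_sqr ler_sqrt ?sqr_ge0//.
rewrite sqrrD !real_normK ?num_real// lerD2r lerDl.
by rewrite mulrn_wge0// mulr_ge0.
Qed.

Lemma Re_le_cabs z : `|complex.Re z| <= cabs z.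
Proof.
by case: z => a b /=; rewrite -sqrtr_sqr ler_sqrt ?addr_ge0 ?sqr_ge0// lerDl sqr_ge0.
Qed.

Lemma Im_le_cabs z : `|complex.Im z| <= cabs z.
Proof.
by case: z => a b /=; rewrite -sqrtr_sqr ler_sqrt ?addr_ge0 ?sqr_ge0// lerDr sqr_ge0.
Qed.

Lemma cis0 : cis 0 = 1 :> R[i].
Proof. by rewrite /cis cos0 sin0. Qed.

Lemma cisD a b : cis (a + b) = cis a * cis b :> R[i].
Proof.
by apply/eqP; rewrite eq_complex /= cosD sinD; apply/andP; split => //; apply/eqP; ring.
Qed.

Lemma cabs_cis a : cabs (cis a) = 1.
Proof. by rewrite /= cos2Dsin2 sqrtr1. Qed.

End complex_modulus.

Section schwartz_space.
Context {R : realType} {d : nat}.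
Local Open Scope complex_scope.
Local Notation V := 'rV[R]_d.
Local Notation C := R[i].
Local Notation cabs := (@ComplexField.Normc.normc R).
Local Notation Re := (@complex.Re R).
Local Notation Im := (@complex.Im R).
Implicit Types (v : V -> R) (f h : V -> C) (x w s t : V).

Lemma partial_lin v v' (a : R) b : smooth v -> smooth v' ->
  partial b (fun s => a * v s + v' s) = (fun s => a * partial b v s + partial b v' s).
Proof.
move=> sv sv'; elim: b => //= i b ->; apply/funext => s.
rewrite (_ : (fun s => _) = a *: partial b v + partial b v')//.
have d1 : derivable (partial b v) s (delta_mx ord0 i).
  by apply: diff_derivable; exact: sv.
rewrite deriveD//; last by apply: diff_derivable; exact: sv'.
  by rewrite deriveZ.
exact: derivableZ.
Qed.

Lemma rschwartz_lin v v' (a : R) : rschwartz v -> rschwartz v' ->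
  rschwartz (fun s => a * v s + v' s).
Proof.
move=> [sv rv] [sv' rv']; split=> b; rewrite partial_lin//.
  move=> s; apply: (@differentiableD _ _ _ (a *: partial b v) (partial b v')) => //.
  by apply: differentiableZ; exact: sv.
move=> n; have [M M0 hM] := rapid_ge0 n (rv b); have [N N0 hN] := rapid_ge0 n (rv' b).
exists (`|a| * M + N) => s.
apply: le_trans (lerD (ler_wpM2l (normr_ge0 a) (hM s)) (hN s)).
rewrite mulrCA -mulrDr ler_wpM2l ?exprn_ge0 ?addr_ge0//.
by rewrite -normrM ler_normD.
Qed.

Lemma rschwartz0 : rschwartz ((fun=> 0) : V -> R).
Proof.
have E b : partial b ((fun=> 0) : V -> R) = (fun=> 0).
  elim: b => //= i b ->; apply/funext => s; exact: derive_cst.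
by split=> b; rewrite E// => n; exists 0 => s; rewrite normr0 mulr0.
Qed.

Lemma rapid_seminorm (F : V -> R) :
  (forall a, exists M, forall s, `|monomial a s| * `|F s| <= M) -> rapid F.
Proof.
move=> H n.
have [M0 h0] := H [::].
have /choice[M hM] : forall i, exists M, forall s, `|monomial (nseq n i) s| * `|F s| <= M.
  by move=> i; exact: H.
exists (2 ^+ n * (M0 + \sum_(i < d) M i)) => s.
apply: le_trans (ler_wpM2r (normr_ge0 _) (monomial_ge n s)) _.
rewrite -mulrA ler_wpM2l ?exprn_ge0// mulrDl lerD//.
  by have := h0 s; rewrite /monomial big_nil normr1.
by rewrite mulr_suml; apply: ler_sum => i _; exact: hM.
Qed.

Lemma schwartz_real f : schwartz f -> rschwartz (Re \o f) /\ rschwartz (Im \o f).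
Proof.
move=> [sR sI fab].
have bnd a b : exists M, forall s, `|monomial a s| * cabs (cpartial b f s) <= M.
  have := fab a b; rewrite /schwartz_seminorm.
  set S := ereal_sup _ => Soo.
  have S0 : (0 <= S)%E.
    apply: le_ereal_sup_tmp; exists (`|monomial a 0| * cabs (cpartial b f 0))%:E.
      by exists 0.
    by rewrite lee_fin mulr_ge0 ?cabs_ge0.
  exists (fine S) => s; rewrite -lee_fin fineK ?ge0_fin_numE//.
  by apply: ereal_sup_ubound; exists s.
by split; split=> // b; apply: rapid_seminorm => a; have [M hM] := bnd a b;
  exists M => s; apply: le_trans (hM s); rewrite ler_wpM2l//;
  [exact: (Re_le_cabs (cpartial b f s))|exact: (Im_le_cabs (cpartial b f s))].
Qed.

Lemma real_schwartz f : rschwartz (Re \o f) -> rschwartz (Im \o f) -> schwartz f.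
Proof.
move=> [sR rR] [sI rI]; split=> // a b.
have [M M0 hM] := rapid_ge0 (size a) (rR b).
have [N N0 hN] := rapid_ge0 (size a) (rI b).
apply: le_lt_trans (ltry (M + N)); apply: ge_ereal_sup => _ [s _ <-].
rewrite lee_fin.
apply: le_trans (_ : (1 + `|s|) ^+ size a *
    (`|partial b (Re \o f) s| + `|partial b (Im \o f) s|) <= _).
  by rewrite ler_pM ?cabs_ge0 ?monomial_le// cabs_le.
by rewrite mulrDr lerD.
Qed.

Lemma schwartz_lin c f h : schwartz f -> schwartz h ->
  schwartz (fun s => c * f s + h s).
Proof.
move=> /schwartz_real[fR fI] /schwartz_real[hR hI]; apply: real_schwartz.
  have -> : Re \o (fun s => c * f s + h s) = (fun s => Re c * (Re \o f) s +
      (- Im c * (Im \o f) s + (Re \o h) s)).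
    by apply/funext => s /=; case: c (f s) (h s) => [? ?] [? ?] [? ?] /=; ring.
  by do 2 apply: rschwartz_lin => //.
have -> : Im \o (fun s => c * f s + h s) = (fun s => Re c * (Im \o f) s +
    (Im c * (Re \o f) s + (Im \o h) s)).
  by apply/funext => s /=; case: c (f s) (h s) => [? ?] [? ?] [? ?] /=; ring.
by do 2 apply: rschwartz_lin => //.
Qed.

Lemma schwartz0 : schwartz ((fun=> 0) : V -> C).
Proof. by apply: real_schwartz; exact: rschwartz0. Qed.

Lemma schwartz_conj f : schwartz f -> schwartz (fun s => (f s)^*).
Proof.
move=> /schwartz_real[fR fI]; apply: real_schwartz.
  by rewrite (_ : Re \o _ = Re \o f)//; apply/funext => s /=; case: (f s).
rewrite (_ : Im \o _ = (fun s => -1 * (Im \o f) s + (fun=> 0) s)); last first.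
  by apply/funext => s /=; case: (f s) => a b /=; rewrite mulN1r addr0.
by apply: rschwartz_lin => //; exact: rschwartz0.
Qed.

Lemma schwartz_sum n (c : 'I_n -> C) (f : 'I_n -> V -> C) :
  (forall i, schwartz (f i)) -> schwartz (fun s => \sum_(i < n) c i * f i s).
Proof.
elim: n c f => [|n IH] c f Sf.
  rewrite (_ : (fun s => _) = fun=> 0); first exact: schwartz0.
  by apply/funext => s; rewrite big_ord0.
rewrite (_ : (fun s => _) = (fun s => c ord0 * f ord0 s +
  \sum_(i < n) c (lift ord0 i) * f (lift ord0 i) s)).
  by apply: schwartz_lin => //; exact: IH.
by apply/funext => s; rewrite big_ord_recl.
Qed.

Section tempered.
Variable u : (V -> C) -> C.
Hypothesis tu : tempered_distribution u.

Lemma tempered0 : u (fun=> 0) = 0.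
Proof.
have [lu _] := tu; have := lu 1 _ _ schwartz0 schwartz0.
under [in LHS]eq_fun do rewrite mulr0 addr0.
by rewrite mul1r => /eqP; rewrite -subr_eq0 opprD addrA subrr sub0r oppr_eq0 => /eqP.
Qed.

Lemma tempered_sum n (c : 'I_n -> C) (f : 'I_n -> V -> C) :
  (forall i, schwartz (f i)) ->
  u (fun s => \sum_(i < n) c i * f i s) = \sum_(i < n) c i * u (f i).
Proof.
elim: n c f => [|n IH] c f Sf.
  rewrite big_ord0 (_ : (fun s => _) = fun=> 0); first exact: tempered0.
  by apply/funext => s; rewrite big_ord0.
rewrite (_ : (fun s => _) = (fun s => c ord0 * f ord0 s +
  \sum_(i < n) c (lift ord0 i) * f (lift ord0 i) s)); last first.
  by apply/funext => s; rewrite big_ord_recl.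
have [lu _] := tu; rewrite lu// ?IH ?big_ord_recl//.
exact: schwartz_sum.
Qed.

(** The sum of seminorms is traded for a single weighted bound [B] on finitely many derivatives, the
    form that the Lipschitz estimates provide: [n] is the largest degree of a monomial involved, and
    the number of seminorms goes into [K]. *)
Lemma tempered_bound : exists n (bs : seq (seq 'I_d)) (K : R), 0 <= K /\
  forall f (B : R), 0 <= B -> schwartz f ->
  (forall b, b \in bs -> forall s, (1 + `|s|) ^+ n * cabs (cpartial b f s) <= B) ->
  cabs (u f) <= K * B.
Proof.
have [_ [l [M uM]]] := tu.
exists (\max_(ab <- l) size ab.1), (map snd l), (`|M| * (size l)%:R); split.
  by rewrite mulr_ge0.
move=> f B B0 Sf H.
rewrite -lee_fin; apply: le_trans (uM f Sf) _.
have sem a b : (a, b) \in l -> (0 <= schwartz_seminorm a b f <= B%:E)%E.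
  move=> abl; apply/andP; split.
    apply: le_ereal_sup_tmp; exists (`|monomial a 0| * cabs (cpartial b f 0))%:E.
      by exists 0.
    by rewrite lee_fin mulr_ge0 ?cabs_ge0.
  apply: ge_ereal_sup => _ [s _ <-]; rewrite lee_fin.
  apply: le_trans (H b _ s); last by apply/mapP; exists (a, b).
  rewrite ler_wpM2r ?cabs_ge0//; apply: le_trans (monomial_le a s) _.
  rewrite ler_weXn2l ?lerDl//.
  by rewrite (big_rem _ abl) leq_max leqnn.
have S0 : (0 <= \sum_(ab <- l) schwartz_seminorm ab.1 ab.2 f)%E.
  by rewrite big_seq; apply: sume_ge0 => -[a b] /sem/andP[].
apply: le_trans (_ : `|M|%:E * \sum_(ab <- l) schwartz_seminorm ab.1 ab.2 f <= _)%E.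
  by rewrite lee_wpmul2r// lee_fin ler_norm.
rewrite -mulrA EFinM lee_wpmul2l//.
apply: le_trans (_ : \sum_(ab <- l) B%:E <= _)%E.
  by rewrite big_seq [leRHS]big_seq; apply: lee_sum => -[a b] /sem/andP[].
rewrite sumEFin lee_fin big_const_seq count_predT iter_addr_0 mulr_natl.
exact: lexx.
Qed.

End tempered.
End schwartz_space.

(** * The short-time Fourier transform of a modulated function *)

Section stft_distribution.
Context {R : realType} {d : nat}.
Local Open Scope complex_scope.
Local Notation V := 'rV[R]_d.
Local Notation C := R[i].
Local Notation cabs := (@ComplexField.Normc.normc R).
Local Notation Re := (@complex.Re R).
Local Notation Im := (@complex.Im R).
Local Notation e_ i := (delta_mx ord0 i : 'rV[R]_d).
Implicit Types (f phi : V -> C) (x w s t : V).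

Hypothesis d_gt0 : (0 < d)%N.

Let conjM (a b : C) : (a * b)^*%C = a^*%C * b^*%C. Proof. exact: rmorphM. Qed.

Let conjMr (a : R) (z : C) : (a%:C * z)^*%C = a%:C * z^*%C.
Proof. by rewrite conjM conjc_real. Qed.

Let conj_sum n (F : 'I_n -> C) : (\sum_(k < n) F k)^*%C = \sum_(k < n) (F k)^*%C.
Proof. exact: raddf_sum. Qed.

(** The test function in [stft_distribution]: V_u f(x, w) is the conjugate of
    [u (tf_shift f x w)]. *)
Definition tf_shift f x w s : C := (f (s + x))^*%C * cis (2 * pi * dot w (s + x)).

(** Expanding conj(a + i b) e^(i theta) gives a cos theta + b sin theta and a sin theta - b cos
    theta; the sines are cosines with phase - pi / 2. *)
Lemma tf_shift_family f : schwartz f -> exists h k,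
  [/\ tf_family h, tf_family k & forall x w, tf_shift f x w =
    (fun s => h x w s +i* k x w s)].
Proof.
move=> /schwartz_real[fR fI].
have := tf_add (tf_atom 0 fR) (tf_atom (- (pi / 2)) fI).
set h := (X in tf_family X) => Fh.
have := tf_add (tf_atom (- (pi / 2)) fR) (tf_scale (-1) (tf_atom 0 fI)).
set k := (X in tf_family X) => Fk.
exists h, k; split=> // x w; apply/funext => s.
rewrite /h /k /tf_shift /= !cosBpihalf !addr0; case: (f _) => a b /=.
by apply/eqP; rewrite eq_complex /=; apply/andP; split; apply/eqP; ring.
Qed.

Lemma tf_family_schwartz h k x w : tf_family h -> tf_family k ->
  schwartz (fun s => h x w s +i* k x w s).
Proof.
move=> Fh Fk; apply: real_schwartz.
  split=> [|b]; first exact: tf_smooth.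
  move=> n; have [h' Fh' hE] := tf_partial b Fh.
  have [M _ hM] := tf_bound n (Num.max `|x| `|w|) Fh'.
  by exists M => s; rewrite (_ : Re \o _ = h x w)// hE hM// le_max lexx ?orbT.
split=> [|b]; first exact: tf_smooth.
move=> n; have [h' Fh' hE] := tf_partial b Fk.
have [M _ hM] := tf_bound n (Num.max `|x| `|w|) Fh'.
by exists M => s; rewrite (_ : Im \o _ = k x w)// hE hM// le_max lexx ?orbT.
Qed.

Lemma tf_shift_schwartz f x w : schwartz f -> schwartz (tf_shift f x w).
Proof.
by move=> /tf_shift_family[h [k [Fh Fk ->]]]; exact: tf_family_schwartz.
Qed.

Lemma tf_family_partial_lipschitz h n (bs : seq (seq 'I_d)) (rho : R) :
  tf_family h -> exists2 M : R, 0 <= M & forall b, b \in bs ->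
  forall x w x' w' s, `|x| <= rho -> `|w| <= rho -> `|x'| <= rho -> `|w'| <= rho ->
    (1 + `|s|) ^+ n * `|partial b (h x w) s - partial b (h x' w') s|
    <= M * (`|x - x'| + `|w - w'|).
Proof.
move=> Fh.
have /choice[M hM] : forall b, exists M : R, 0 <= M /\
  forall x w x' w' s, `|x| <= rho -> `|w| <= rho -> `|x'| <= rho -> `|w'| <= rho ->
    (1 + `|s|) ^+ n * `|partial b (h x w) s - partial b (h x' w') s|
    <= M * (`|x - x'| + `|w - w'|).
  move=> b; have [k Fk kE] := tf_partial b Fh.
  have [M M0 kM] := tf_lipschitz n rho Fk.
  by exists M; split=> // x w x' w' s; rewrite !kE; exact: kM.
exists (\sum_(b <- bs) M b).
  by apply: sumr_ge0 => b _; have [] := hM b.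
move=> b bbs x w x' w' s xr wr x'r w'r.
have [Mb0 Mb] := hM b; apply: le_trans (Mb _ _ _ _ s xr wr x'r w'r) _.
rewrite ler_wpM2r ?addr_ge0// (big_rem b)//= lerDl.
by apply: sumr_ge0 => b' _; have [] := hM b'.
Qed.

Section window.
Variable u : (V -> C) -> C.
Hypothesis tu : tempered_distribution u.

(** Linearity turns a difference of two values into [u] of a difference of test functions, which
    [tempered_bound] controls by the Lipschitz bounds for the family. *)
Lemma stft_distribution_lipschitz f (rho : R) : schwartz f -> exists2 M : R, 0 <= M &
  forall x w x' w', `|x| <= rho -> `|w| <= rho -> `|x'| <= rho -> `|w'| <= rho ->
  cabs (stft_distribution u f (x, w) - stft_distribution u f (x', w'))
  <= M * (`|x - x'| + `|w - w'|).
Proof.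
move=> Sf; have [h [k [Fh Fk hkE]]] := tf_shift_family Sf.
have [n [bs [K [K0 uK]]]] := tempered_bound tu.
have [M M0 hM] := tf_family_partial_lipschitz n bs rho Fh.
have [N N0 kN] := tf_family_partial_lipschitz n bs rho Fk.
exists (K * (M + N)); first by rewrite mulr_ge0 ?addr_ge0.
move=> x w x' w' xr wr x'r w'r.
rewrite -[stft_distribution u f (x, w)]/((u (tf_shift f x w))^*%C).
rewrite -[stft_distribution u f (x', w')]/((u (tf_shift f x' w'))^*%C).
have [lu _] := tu.
have uE : u (tf_shift f x w) - u (tf_shift f x' w') =
    u (fun s => (-1) * tf_shift f x' w' s + tf_shift f x w s).
  rewrite lu; [|exact: tf_shift_schwartz..].
  by rewrite mulN1r addrC.
rewrite -rmorphB cabsJ uE -mulrA; apply: uK.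
- by rewrite mulr_ge0 ?addr_ge0.
- by apply: schwartz_lin; exact: tf_shift_schwartz.
move=> b bbs s; rewrite mulrDl.
apply: le_trans (lerD (hM b bbs _ _ _ _ s xr wr x'r w'r)
  (kN b bbs _ _ _ _ s xr wr x'r w'r)).
rewrite -mulrDr ler_wpM2l ?exprn_ge0 ?addr_ge0//.
apply: le_trans (cabs_le _ _) _; rewrite !hkE.
have sm (g : V -> V -> V -> R) y v : tf_family g -> smooth (g y v) by move=> Fg; exact: tf_smooth.
rewrite (_ : Re \o _ = (fun s => -1 * h x' w' s + h x w s)); last first.
  by apply/funext => y /=; ring.
rewrite (_ : Im \o _ = (fun s => -1 * k x' w' s + k x w s)); last first.
  by apply/funext => y /=; ring.
rewrite !partial_lin; try exact: sm.
by rewrite !mulN1r ![- _ + _]addrC.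
Qed.

Definition trig_poly n (c : nat -> R) (r : R) : C :=
  \sum_(k < n) (c k)%:C * cis (2 * pi * k%:R * r).

(** The polynomial is dilated by a natural number [L], so that the frequencies k L are integers and
    the corresponding translations preserve the grid of unit cubes. *)
Definition modulate n (c : nat -> R) (L : nat) i f t : C :=
  f t * trig_poly n c (L%:R * t ord0 i).

Lemma modulateE n c L i f : modulate n c L i f =
  (fun t => \sum_(k < n) (c k)%:C * (tf_shift f 0 (- (k * L)%:R *: e_ i) t)^*%C).
Proof.
apply/funext => t; rewrite /modulate /trig_poly mulr_sumr; apply: eq_bigr => k _.
rewrite /tf_shift addr0 mulrCA; congr (_ * _).
rewrite conjM conjcK cisN; congr (_ * cis _).
have dotE : dot (- (k * L)%:R *: e_ i) t = - ((k * L)%:R * t ord0 i).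
  rewrite /dot (bigD1 i)//= !mxE !eqxx mulr1 big1 ?addr0 ?mulNr// => j ji.
  by rewrite !mxE (negbTE ji) andbF mulr0 mul0r.
by rewrite dotE natrM; ring.
Qed.

Lemma modulate_schwartz n c L i f : schwartz f -> schwartz (modulate n c L i f).
Proof.
move=> Sf; rewrite modulateE.
by apply: schwartz_sum => k; exact/schwartz_conj/tf_shift_schwartz.
Qed.

(** Covariance of the transform: modulating f by e^(2 pi i k L t_i) translates V_u f in the
    frequency variable, without any phase factor. The rest is linearity of [u]. *)
Lemma stft_modulate n c L i f x w : schwartz f ->
  stft_distribution u (modulate n c L i f) (x, w) =
  \sum_(k < n) (c k)%:C * stft_distribution u f (x, w - (k * L)%:R *: e_ i).
Proof.
move=> Sf; rewrite -[LHS]/((u (tf_shift (modulate n c L i f) x w))^*%C).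
have -> : tf_shift (modulate n c L i f) x w = (fun s => \sum_(k < n)
    (c k)%:C * tf_shift f x (w - (k * L)%:R *: e_ i) s).
  apply/funext => s; rewrite {1}/tf_shift modulateE conj_sum mulr_suml.
  apply: eq_bigr => k _; rewrite conjMr conjcK -mulrA; congr (_ * _).
  rewrite /tf_shift addr0 -mulrA -cisD; congr (_ * cis _).
  by rewrite dotDl scaleNr; ring.
rewrite tempered_sum//; last by move=> k; exact: tf_shift_schwartz.
by rewrite conj_sum; apply: eq_bigr => k _; exact: conjMr.
Qed.

End window.
End stft_distribution.

(** * Measurability *)

Section measurability.
Context {R : realType}.

Lemma measurable_rV_forall n (P : 'I_n -> set R) :
  (forall i, measurable (P i)) -> measurable [set v : 'rV[R]_n | forall i, P i (v ord0 i)].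
Proof.
move=> mP.
rewrite (_ : [set v | _] = ~` \bigcup_i ((fun v : 'rV[R]_n => v ord0 i) @^-1` (~` P i))).
  apply: measurableC; apply: countable_bigcupT_measurable => [|i].
    exact: finite_set_countable.
  rewrite -[X in measurable X]setTI; apply: measurable_rV_coord => //.
  exact: measurableC.
apply/seteqP; split=> v /= H.
  by move=> [i _ /=]; apply; exact: H.
by move=> i; apply: contrapT => nP; apply: H; exists i.
Qed.

Lemma measurable_cube n (k : 'rV[int]_n) : measurable (cube k : set 'rV[R]_n).
Proof.
pose P i : set R := `[(k ord0 i)%:~R, (k ord0 i)%:~R + 1[%classic.
rewrite (_ : cube k = [set v | forall i, P i (v ord0 i)]).
  by apply: measurable_rV_forall => i; exact: measurable_itv.
by apply/seteqP; split=> v /= H i; have := H i; rewrite /P /= in_itv.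
Qed.

Lemma measurable_fun_countable d (T : measurableType d) (K : countType)
  (r : T -> K) (h : K -> R) :
  (forall k, measurable (r @^-1` [set k])) -> measurable_fun setT (h \o r).
Proof.
move=> mr _ Y mY; rewrite setTI.
rewrite (_ : _ @^-1` Y = \bigcup_(k : K) (if `[< Y (h k) >] then r @^-1` [set k] else set0)).
  apply: countable_bigcupT_measurable; first exact: countableP.
  by move=> k; case: ifP.
apply/seteqP; split=> t /=.
  by move=> Yt; exists (r t) => //; rewrite (asboolT Yt).
by move=> [k _]; case: asboolP => // Yk /= ->.
Qed.

(** The measurable structure is generated by the coordinates. [G] is the pointwise limit of its
    values [Gm] at the grid points of mesh 1 / (m + 1) below the argument, and a function of the
    grid point takes countably many values, on measurable cells. *)
Lemma measurable_fun_locally_lipschitz n (G : 'rV[R]_n * 'rV[R]_n -> R) :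
  (forall rho : R, exists2 M : R, 0 <= M & forall x w x' w', `|x| <= rho -> `|w| <= rho ->
    `|x'| <= rho -> `|w'| <= rho ->
    `|G (x, w) - G (x', w')| <= M * (`|x - x'| + `|w - w'|)) ->
  measurable_fun setT G.
Proof.
move=> HG.
pose fl m (v : 'rV[R]_n) : 'rV[int]_n := \row_i Num.floor (m.+1%:R * v ord0 i).
pose ap m (k : 'rV[int]_n) : 'rV[R]_n := \row_i ((k ord0 i)%:~R / m.+1%:R).
have apE m v : `|v - ap m (fl m v)| <= m.+1%:R^-1.
  rewrite [leLHS](@mx_normrE R 1 n); apply/bigmax_leP; split=> // -[a i] _ /=.
  rewrite ord1 !mxE.
  have /andP[A B] := floor_itv (m.+1%:R * v ord0 i).
  have m0 : 0 < m.+1%:R :> R by rewrite ltr0n.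
  have E : (Num.floor (m.+1%:R * v ord0 i))%:~R / m.+1%:R <= v ord0 i.
    by rewrite ler_pdivrMr// (mulrC (v ord0 i)).
  rewrite ger0_norm ?subr_ge0// lerBlDr -[X in X + _]mul1r -mulrDl.
  rewrite ler_pdivlMr// (mulrC (v ord0 i)) addrC; move: B; by rewrite intrD => /ltW.
pose Gm m z := G (ap m (fl m z.1), ap m (fl m z.2)).
apply: (@measurable_fun_cvg _ _ _ _ Gm) => [m|[x w] _].
  apply: (@measurable_fun_countable _ _ ('rV[int]_n * 'rV[int]_n)%type
    (fun z => (fl m z.1, fl m z.2)) (fun k => G (ap m k.1, ap m k.2))) => -[k l].
  have mfl j : measurable (fl m @^-1` [set j]).
    pose P i := [set r : R | Num.floor (m.+1%:R * r) = j ord0 i].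
    rewrite (_ : fl m @^-1` [set j] = [set v | forall i, P i (v ord0 i)]).
      apply: measurable_rV_forall => i; rewrite /P.
      rewrite (_ : [set r | _] = `[(j ord0 i)%:~R / m.+1%:R, (j ord0 i + 1)%:~R / m.+1%:R[%classic).
        exact: measurable_itv.
      apply/seteqP; split=> r /=; rewrite in_itv /= ler_pdivrMr ?ltr0n// ltr_pdivlMr ?ltr0n// (mulrC r).
        by move/eqP; rewrite floor_eq.
      by rewrite -floor_eq => /eqP.
    apply/seteqP; split=> v /=; first by move=> e i; rewrite /P /= -e mxE.
    by move=> H; apply/rowP => i; rewrite mxE; exact: H.
  rewrite (_ : (fun z => (fl m z.1, fl m z.2)) @^-1` [set (k, l)] = (fl m @^-1` [set k]) `*` (fl m @^-1` [set l])).
    exact: measurableX.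
  by apply/seteqP; split=> [[y z] [/= -> ->]|[y z] [/= -> ->]].
(* The extra 1 leaves room for the grid points, which are at distance at most 1 from [x] and [w]. *)
pose rho := `|x| + `|w| + 1.
have [M M0 HM] := HG rho.
apply/cvgrPdist_le => e e0.
have [N] : exists N : nat, 2 * M / e <= N%:R.
  exists (Num.truncn (2 * M / e)).+1; exact/ltW/truncnS_gt.
move=> NP; near=> m.
have mN : (N <= m)%N by near: m; exists N.
have inv1 : m.+1%:R^-1 <= 1 :> R by rewrite invf_le1 ?ler1n ?ltr0n.
have ap_rho v : `|v| <= `|x| + `|w| -> `|ap m (fl m v)| <= rho.
  move=> vr; rewrite -[ap _ _](subrK v); apply: le_trans (ler_normD _ _) _.
  rewrite distrC addrC /rho lerD//; exact: le_trans (apE _ _) inv1.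
rewrite /Gm /=.
have r0 : 0 <= `|x| + `|w| by rewrite addr_ge0.
apply: le_trans (HM x w _ _ _ _ _ _) _; rewrite ?ap_rho ?lerDl ?lerDr//.
- by rewrite /rho -addrA lerDl addr_ge0.
- by rewrite /rho addrAC lerDr addr_ge0.
apply: le_trans (_ : M * (m.+1%:R^-1 + m.+1%:R^-1) <= _).
  by rewrite ler_wpM2l// lerD.
rewrite (_ : M * _ = 2 * M / m.+1%:R); last by ring.
rewrite ler_pdivrMr ?ltr0n// -ler_pdivrMl// mulrC.
by apply: le_trans NP _; rewrite ler_nat ltnW.
Unshelve. all: by end_near. Qed.

End measurability.

(** * Amalgam norms *)

Section Lnorm_unit_set.
Context {R : realType} {dT : measure_display} {T : measurableType dT}.
Variables (mu : {measure set T -> \bar R}) (Q : set T).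
Hypotheses (mQ : measurable Q) (muQ : mu Q = 1%E).
Implicit Types (f k : T -> R) (p : \bar R) (r a N : R).
Local Open Scope ereal_scope.

Let measurable_mul_indic f : measurable_fun setT f ->
  measurable_fun setT (fun t => f t * \1_Q t)%R.
Proof. by move=> mf; apply: measurable_funM => //; exact: measurable_indic. Qed.

Lemma integral_mul_indic f : (forall t, 0 <= f t)%R ->
  \int[mu]_(t in Q) (f t)%:E = \int[mu]_t (f t * \1_Q t)%:E.
Proof.
move=> f0; rewrite integral_mkcond; apply: eq_integral => t _.
by rewrite patchE indicE; case: ifP => tQ; rewrite ?mulr1 ?mulr0.
Qed.

(** Hoelder against the indicator of [Q], whose conjugate norm is 1 since [Q] has measure one. *)
Lemma L1_le_Lnorm f p : measurable_fun setT f -> (forall t, 0 <= f t)%R ->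
  1 <= p -> \int[mu]_(t in Q) (f t)%:E <= Lnorm mu p (fun t => (f t * \1_Q t)%:E).
Proof.
move=> mf f0; have fQ0 t : (0 <= f t * \1_Q t)%R by rewrite mulr_ge0.
rewrite integral_mul_indic//.
have iN1 : \int[mu]_t (f t * \1_Q t)%:E = Lnorm mu 1 (fun t => (f t * \1_Q t)%:E).
  by rewrite Lnorm1; apply: eq_integral => t _; rewrite gee0_abs ?lee_fin.
case: p => [r||//].
(* The case r = 1 is set apart: there 1 - r^-1 = 0, whose inverse is 0 by convention and not a
   conjugate exponent. *)
- rewrite iN1 lee_fin le_eqVlt => /predU1P[<-//|r1].
  have r0 : (0 < r)%R by exact: lt_trans r1.
  have r'0 : (0 < 1 - r^-1)%R by rewrite subr_gt0 invf_lt1.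
  have := @hoelder _ _ _ mu (fun t => f t * \1_Q t)%R (\1_Q) r (1 - r^-1)^-1%R
    (measurable_mul_indic mf) (measurable_indic mQ) r0.
  rewrite invr_gt0 invrK subrKC => /(_ r'0 erefl).
  rewrite (_ : _ \o _ = (fun t => (f t * \1_Q t)%:E)); last first.
    apply/funext => t /=; rewrite -mulrA; congr (_ * _)%:E.
    by rewrite indicE; case: (t \in Q); rewrite ?mulr1 ?mulr0.
  set N' := (X in _ * X) => H; apply: le_trans H _.
  suff -> : N' = 1 by rewrite mule1.
  rewrite /N' unlock /= (_ : (fun t => _) = (fun t => (\1_Q t)%:E)); last first.
    apply/funext => t; rewrite indicE; case: (t \in Q) => /=.
      by rewrite normr1 powR1.
    by rewrite normr0 powR0// gt_eqF// invr_gt0.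
  by rewrite integral_indic// setIT muQ poweR_EFin powR1.
- move=> _; rewrite unlock.
  (* The infinite case of [Lnorm] is an essential supremum only if the whole space has positive
     measure. *)
  have -> : 0 < mu setT.
    apply: lt_le_trans (_ : mu Q <= _); first by rewrite muQ.
    by apply: le_measure; rewrite ?inE.
  set S := ess_sup _ _.
  have S0 : 0 <= S.
    apply: ess_sup_gee => //; last by apply: nearW => t; exact: abse_ge0.
    apply: lt_le_trans (_ : mu Q <= _); first by rewrite muQ.
    by apply: le_measure; rewrite ?inE.
  rewrite -integral_mul_indic//.
  apply: le_trans (_ : \int[mu]_(t in Q) cst S t <= _); last first.
    by rewrite integral_cst// muQ mule1.
  apply: ae_ge0_le_integral => //.
  - by move=> t _; rewrite lee_fin.
  - by apply/measurable_EFinP; exact: measurable_funTS.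
  - have := ess_sup_ge mu (abse \o (fun t => (f t * \1_Q t)%:E)).
    apply: filterS => t /= + Qt; rewrite indicE mem_set// mulr1.
    by rewrite ger0_norm.
Qed.

(** Pointwise k^r <= N^(r - 1) k, and [k] has mean at most 1 on [Q]: its L^r norm there is at most
    N^(1 - 1/r). *)
Lemma Lnorm_le_weighted f k r a N : (1 <= r)%R -> (0 <= a)%R -> (0 < N)%R ->
  measurable_fun setT f -> measurable_fun setT k ->
  (forall t, 0 <= k t <= N)%R -> (\int[mu]_(t in Q) (k t)%:E <= 1) ->
  (forall t, Q t -> `|f t| <= a * k t)%R ->
  Lnorm mu r%:E (fun t => (f t * \1_Q t)%:E) <= (a * N `^ (1 - r^-1))%:E.
Proof.
move=> r1 a0 N0 mf mk kN ik fk.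
have r0 : (0 < r)%R by exact: lt_le_trans r1.
have rr : (r - 1 + 1 = r)%R by rewrite subrK.
rewrite unlock.
apply: le_trans (_ : (a `^ r * N `^ (r - 1))%:E `^ r^-1 <= _); last first.
  rewrite poweR_EFin powRM ?powR_ge0// -!powRrM mulfV ?gt_eqF// powRr1// lee_fin.
  by rewrite mulrBl mulfV ?gt_eqF// mul1r.
apply: gt0_ler_poweR; rewrite ?invr_ge0 ?(ltW r0)// ?in_itv/= ?leey ?andbT.
- by apply: integral_ge0 => t _; rewrite ?poweR_ge0 ?lee_fin ?powR_ge0.
- by rewrite lee_fin mulr_ge0 ?powR_ge0.
apply: le_trans (_ : \int[mu]_t ((a `^ r * N `^ (r - 1))%:E * (k t * \1_Q t)%:E) <= _).
  apply: ge0_le_integral => //.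
  - apply/measurable_EFinP.
    apply: (@measurableT_comp _ _ _ _ _ _ (@powR R ^~ r)) => //.
    by apply: measurableT_comp => //; exact: measurable_mul_indic.
  - apply/measurable_EFinP; apply: measurable_funM => //.
    exact: measurable_mul_indic.
  - move=> t _; rewrite -EFinM lee_fin indicE.
    have /andP[k0 kNt] := kN t.
    have [/[!inE] Qt|_] := boolP (t \in Q); last first.
      by rewrite !mulr0 normr0 powR0 ?gt_eqF.
    rewrite !mulr1.
    apply: le_trans (_ : (a * k t) `^ r <= _)%R.
      by rewrite ge0_ler_powR ?nnegrE ?mulr_ge0 ?(ltW r0)// fk.
    rewrite powRM// -mulrA ler_wpM2l ?powR_ge0//.
    have [->|kt0] := eqVneq (k t) 0%R; first by rewrite powR0 ?gt_eqF// mulr0.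
    rewrite -[X in (_ `^ X <= _)%R]rr powRD; last by apply/implyP.
    rewrite powRr1// ler_wpM2r// ge0_ler_powR ?nnegrE ?subr_ge0//.
    exact: ltW.
rewrite ge0_integralZl//.
- apply: le_trans (_ : _ * 1 <= _); last by rewrite mule1.
  rewrite lee_wpmul2l ?lee_fin ?mulr_ge0 ?powR_ge0//.
  by rewrite -integral_mul_indic// => t; have /andP[] := kN t.
- by apply/measurable_EFinP; exact: measurable_mul_indic.
- by move=> t _; rewrite lee_fin mulr_ge0//; have /andP[] := kN t.
- by rewrite lee_fin mulr_ge0 ?powR_ge0.
Qed.

Lemma Lnorm_le_bounded f p a : 1 <= p -> (0 <= a)%R -> measurable_fun setT f ->
  (forall t, Q t -> `|f t| <= a)%R ->
  Lnorm mu p (fun t => (f t * \1_Q t)%:E) <= a%:E.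
Proof.
move=> p1 a0 mf fa; case: p p1 => [r||//].
- rewrite lee_fin => r1.
  have -> : a = (a * 1 `^ (1 - r^-1))%R by rewrite powR1 mulr1.
  apply: (@Lnorm_le_weighted _ (cst 1%R)) => //.
  - by move=> t; rewrite ler01 lexx.
  - by rewrite (integral_cst mu mQ 1) mul1e muQ.
  - by move=> t /fa; rewrite mulr1.
- move=> _; rewrite unlock; case: ifPn => // _.
  apply/ess_supP/nearW => t /=; rewrite lee_fin indicE.
  have [/[!inE] Qt|_] := boolP (t \in Q); last by rewrite mulr0 normr0.
  by rewrite mulr1 fa.
Qed.

End Lnorm_unit_set.

Section amalgam.
Context {R : realType} {dT : measure_display} {T : measurableType dT}.
Variables (mu : {measure set T -> \bar R}) (K : choiceType) (Q : K -> set T).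
Variables (p : \bar R) (r : R) (f : T -> R[i]).
Hypothesis r1 : 1 <= r.
Local Notation cabs := (@ComplexField.Normc.normc R).
Let a k := Lnorm mu p (fun t => (cabs (f t) * \1_(Q k) t)%:E).
Local Open Scope ereal_scope.

Let r0 : (0 < r)%R. Proof. exact: lt_le_trans r1. Qed.

Lemma amalgam_norm_ge (m : nat) (kappa : 'I_m -> K) (b : R) :
  injective kappa -> (0 <= b)%R -> (forall j, b%:E <= a (kappa j)) ->
  (m%:R `^ r^-1 * b)%:E <= amalgam_norm mu Q p r%:E f.
Proof.
move=> inj b0 H; rewrite /amalgam_norm -/a.
have -> : (m%:R `^ r^-1 * b)%:E = (\sum_(j < m) b%:E `^ r) `^ r^-1.
  under eq_bigr do rewrite poweR_EFin.
  rewrite sumEFin sumr_const card_ord poweR_EFin -(mulr_natl (b `^ r)) powRM ?powR_ge0//.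
  by rewrite -powRrM mulfV ?gt_eqF// powRr1.
have es0 : 0 <= \esum_(k in [set: K]) a k `^ r.
  by apply: esum_ge0 => k _; exact: poweR_ge0.
apply: gt0_ler_poweR; rewrite ?invr_ge0 ?(ltW r0)// ?in_itv/= ?leey ?andbT//.
  by apply: sume_ge0 => j _; rewrite lee_fin powR_ge0.
apply: esum_ge; exists [set` map kappa (enum 'I_m)].
  by split => //; exact: finite_seq.
have us : uniq (map kappa (enum 'I_m)) by rewrite map_inj_uniq ?enum_uniq.
rewrite -(fsbig_seq _ (fun k => a k `^ r) us) big_map big_enum/=.
apply: lee_sum => j _; rewrite -poweR_EFin.
apply: gt0_ler_poweR; rewrite ?(ltW r0)// ?in_itv/= ?leey ?andbT ?lee_fin//.
exact: Lnorm_ge0.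
Qed.

(** Otherwise infinitely many cubes carry a norm of at least [e], and [amalgam_norm_ge] applied to m
    of them makes the total at least m^(1/r) e, for every m. *)
Lemma amalgam_norm_tail (kappa : nat -> K) (e : R) : injective kappa ->
  (0 < e)%R -> amalgam_norm mu Q p r%:E f < +oo ->
  exists N, forall m, (N <= m)%N -> a (kappa m) < e%:E.
Proof.
move=> inj e0 foo; apply: contrapT => H.
have /choice[g gP] : forall N, exists m, (N <= m)%N /\ e%:E <= a (kappa m).
  move=> N; apply: contrapT => nH; apply: H; exists N => m Nm.
  by rewrite ltNge; apply/negP => em; apply: nH; exists m.
(* Each index is sought beyond the previous one, so [h] is strictly increasing and the cubes are
   distinct. *)
pose h n := iter n (fun m => g m.+1) (g 0%N).
have hinc : {homo h : i j / (i < j)%N >-> (i < j)%N}.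
  apply: homo_ltn => [y x z|i]; first exact: ltn_trans.
  by rewrite /h iterS; have [] := gP (iter i (fun m => g m.+1) (g 0%N)).+1.
have hinj : injective h.
  move=> i j hij; case: (ltngtP i j) => // ij;
    by have := hinc _ _ ij; rewrite hij ltnn.
have he n : e%:E <= a (kappa (h n)).
  by case: n => [|n]; [have [] := gP 0%N|have [] := gP (h n).+1].
have bnd m : (m%:R `^ r^-1 * e)%:E <= amalgam_norm mu Q p r%:E f.
  apply: (@amalgam_norm_ge _ (fun j : 'I_m => kappa (h j))) => //.
  - by move=> i j /inj /hinj ij; exact: val_inj.
  - exact: ltW.
have A0 : 0 <= amalgam_norm mu Q p r%:E f by exact: poweR_ge0.
have Afin : amalgam_norm mu Q p r%:E f \is a fin_num by rewrite ge0_fin_numE.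
move: bnd; rewrite -(fineK Afin).
set S := fine _ => bnd.
have S0 : (0 <= S)%R by rewrite fine_ge0.
pose m := (Num.truncn ((S / e) `^ r)).+1.
have := bnd m; rewrite lee_fin -ler_pdivlMr// => mS.
have : (m%:R <= (S / e) `^ r)%R.
  rewrite -[leLHS]powRr1// -[X in (_ `^ X <= _)%R](mulVf (lt0r_neq0 r0)) powRrM.
  apply: ge0_ler_powR => //; rewrite ?nnegrE ?powR_ge0//; first exact: ltW.
  by rewrite divr_ge0// ltW.
by move=> mle; have := truncnS_gt ((S / e) `^ r); rewrite ltNge mle.
Qed.

(** As 0 <= w <= 1 and r >= 1, w^r <= w: summability of the weights themselves suffices, for every
    r. *)
Lemma amalgam_norm_le (w : K -> R) (A G : R) : (0 <= A)%R ->
  (forall k, 0 <= w k <= 1)%R -> (forall k, a k <= (A * w k)%:E) ->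
  (forall s : seq K, uniq s -> \sum_(k <- s) w k <= G)%R ->
  amalgam_norm mu Q p r%:E f <= (A * G `^ r^-1)%:E.
Proof.
move=> A0 w01 aw wG; rewrite /amalgam_norm -/a.
have G0 : (0 <= G)%R by have := wG [::] isT; rewrite big_nil.
have -> : (A * G `^ r^-1)%:E = (A `^ r * G)%:E `^ r^-1.
  by rewrite poweR_EFin powRM ?powR_ge0// -powRrM mulfV ?gt_eqF// powRr1.
apply: gt0_ler_poweR; rewrite ?invr_ge0 ?(ltW r0)// ?in_itv/= ?leey ?andbT//.
- by apply: esum_ge0 => k _; exact: poweR_ge0.
- by rewrite lee_fin mulr_ge0 ?powR_ge0.
apply: ge_ereal_sup => _ [X [finX _] <-].
rewrite fsbig_finite//.
apply: le_trans (_ : \sum_(k <- finmap.enum_fset (fset_set X)) (A `^ r * w k)%:E <= _).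
  apply: lee_sum => k _; have /andP[w0 w1] := w01 k.
  apply: le_trans (_ : (A * w k)%:E `^ r <= _).
    apply: gt0_ler_poweR; rewrite ?(ltW r0)// ?in_itv/= ?leey ?andbT ?lee_fin ?mulr_ge0//.
      exact: Lnorm_ge0.
    exact: aw.
  rewrite poweR_EFin lee_fin powRM// ler_wpM2l ?powR_ge0//.
  move: w0; rewrite le_eqVlt => /predU1P[<-|w0]; first by rewrite powR0 ?gt_eqF.
  by rewrite ge1r_powR// w0.
rewrite sumEFin lee_fin -mulr_sumr ler_wpM2l ?powR_ge0// wG//.
Qed.

End amalgam.

(** * Unit cubes *)

Section cubes.
Context {R : realType} {d : nat}.
Local Notation V := 'rV[R]_d.
Local Notation cabs := (@ComplexField.Normc.normc R).

(** The square makes the weight summable in each coordinate, and the product form lets the sum over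
    the lattice factor. *)
Definition cube_weight (k : 'rV[int]_d) : R :=
  \prod_(i < d) ((1 + `|k ord0 i|%:~R) ^- 2).

Let factor_bound (k : int) : 0 <= (1 + `|k|%:~R : R) ^- 2 <= 1.
Proof.
have k1 : 1 <= 1 + `|k|%:~R :> R by rewrite lerDl ler0z.
rewrite invr_ge0 exprn_ge0 ?(le_trans ler01)//=.
by rewrite invf_le1 ?exprn_gt0 ?(lt_le_trans ltr01)// exprn_ege1.
Qed.

Lemma cube_weight01 k : 0 <= cube_weight k <= 1.
Proof.
have fb i := factor_bound (k ord0 i).
apply/andP; split; first by apply: prodr_ge0 => i _; have /andP[] := fb i.
by apply: prodr_ile1 => i _; exact: fb.
Qed.

(** Telescoping: 1/(a + 1)^2 falls short of 1/a - 1/(a + 1) by exactly 1/(a (a + 1)^2). The term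
    subtracted on the right carries the induction. *)
Lemma sum_inv_sqr n : \sum_(m < n.+1) (1 + m%:R : R) ^- 2 <= 2 - n.+1%:R^-1.
Proof.
elim: n => [|n IH]; first by rewrite big_ord1 addr0 expr1n invr1; lra.
rewrite big_ord_recr /=; apply: le_trans (lerD IH (lexx _)) _.
rewrite -(natr1 n.+1) (addrC 1).
set a : R := n.+1%:R; have a0 : 0 < a by rewrite ltr0n.
have a1 : 0 < a + 1 by rewrite addr_gt0.
have -> : (a + 1) ^- 2 = a^-1 - (a + 1)^-1 - (a * (a + 1) ^+ 2)^-1.
  by field; rewrite !gt_eqF.
have : 0 <= (a * (a + 1) ^+ 2)^-1.
  by rewrite invr_ge0 mulr_ge0 ?exprn_ge0// ltW.
move: a^-1 (a + 1)^-1 (a * _)^-1 => x y z; lra.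
Qed.

(** A finite set of indices lies in a box [-N, N]^d, over which the sum of products is a product of
    one-dimensional sums, each at most 4: two signs times the bound 2 of [sum_inv_sqr]. *)
Lemma sum_cube_weight (s : seq 'rV[int]_d) : uniq s ->
  \sum_(k <- s) cube_weight k <= 4 ^+ d.
Proof.
move=> us; pose N := \max_(k <- s) \max_(i < d) `|k ord0 i|%N.
have kN k i : k \in s -> (`|k ord0 i| <= N)%N.
  move=> ks; apply: leq_trans (leq_bigmax_seq _ ks isT).
  exact: (leq_bigmax_cond (F := fun i => `|k ord0 i|%N)).
(* An integer is encoded by its absolute value and its sign. Zero has two codes, which only enlarges
   the upper bound. *)
pose J : finType := ('I_N.+1 * bool)%type.
pose phi (j : J) : int := if j.2 then - (j.1 : nat)%:Z else (j.1 : nat)%:Z.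
pose psi (k : int) : J := (inord `|k|%N, k < 0).
have phiK k : (`|k| <= N)%N -> phi (psi k) = k.
  move=> kn; rewrite /phi /= inordK ?ltnS// abszE.
  by case: ifPn => [k0|]; [rewrite ltr0_norm ?opprK|rewrite -leNgt => k0; rewrite ger0_norm].
pose Psi (k : 'rV[int]_d) : {ffun 'I_d -> J} := [ffun i => psi (k ord0 i)].
pose W (f : {ffun 'I_d -> J}) : R := \prod_(i < d) (1 + `|phi (f i)|%:~R) ^- 2.
have W0 f : 0 <= W f.
  by apply: prodr_ge0 => i _; have /andP[] := factor_bound (phi (f i)).
have -> : \sum_(k <- s) cube_weight k = \sum_(f <- map Psi s) W f.
  rewrite big_map; apply: eq_big_seq => k ks; apply: eq_bigr => i _.
  by rewrite ffunE phiK// kN.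
rewrite big_uniq/=; last first.
  rewrite map_inj_in_uniq// => k k' ks k's /ffunP kk'; apply/rowP => i.
  by have := kk' i; rewrite !ffunE => /(congr1 phi); rewrite !phiK ?kN.
apply: le_trans (_ : \sum_f W f <= _).
  by rewrite [leRHS](bigID (mem (map Psi s)))/= lerDl sumr_ge0.
rewrite /W -(bigA_distr_bigA (fun (i : 'I_d) (j : J) => (1 + `|phi j|%:~R : R) ^- 2)) /=.
rewrite prodr_const card_ord lerXn2r ?nnegrE//.
  by apply: sumr_ge0 => j _; have /andP[] := factor_bound (phi j).
rewrite (eq_bigr (fun j : J => (fun (m : 'I_N.+1) (b : bool) => (1 + (m : nat)%:R : R) ^- 2) j.1 j.2)); last first.
  by move=> [m b] _; rewrite /phi /=; case: b; rewrite ?normrN.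
rewrite -(pair_bigA _ (fun (m : 'I_N.+1) (b : bool) => (1 + (m : nat)%:R : R) ^- 2)) /=.
under eq_bigr do rewrite big_bool /= -mulr2n.
rewrite sumrMnl mulr2n.
apply: le_trans (lerD (sum_inv_sqr N) (sum_inv_sqr N)) _.
have : 0 <= N.+1%:R^-1 :> R by rewrite invr_ge0.
by move: (N.+1%:R^-1) => x; lra.
Qed.

Lemma schwartz_cube_weight (f : V -> R[i]) : schwartz f ->
  exists2 A : R, 0 <= A & forall k t, cube k t -> cabs (f t) <= A * cube_weight k.
Proof.
move=> /schwartz_real[fR fI].
have [M M0 hM] := rapid_ge0 (2 * d) (rschwartz_rapid fR).
have [N N0 hN] := rapid_ge0 (2 * d) (rschwartz_rapid fI).
exists (4 ^+ d * (M + N)) => [|k t kt]; first by rewrite mulr_ge0 ?addr_ge0.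
(* On [cube k] each 1 + |k_i| is at most 2 (1 + |t|); the d squared factors give 4^d (1 + |t|)^(2
   d). *)
have tw : 1 <= 4 ^+ d * (1 + `|t|) ^+ (2 * d) * cube_weight k.
  rewrite exprM -exprMn /cube_weight -[X in _ ^+ X](card_ord d) -prodr_const.
  rewrite -big_split/=; apply: (big_ind (fun x => 1 <= x)) => [//|x y|i _]; first exact: mulr_ege1.
  have k0 : 0 < 1 + `|k ord0 i|%:~R :> R by rewrite ltr_pwDl// ler0z.
  rewrite ler_pdivlMr ?exprn_gt0// mul1r.
  have : (1 + `|k ord0 i|%:~R) <= 2 * (1 + `|t|).
    have ti := norm_coord_le t i; have /andP[a b] := kt i.
    have /andP[t1 t2] : - `|t| <= t ord0 i <= `|t| by rewrite -ler_norml.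
    suff : `|(k ord0 i)%:~R| <= 1 + `|t| by rewrite intr_norm; lra.
    by rewrite ler_norml; apply/andP; split; lra.
  by move=> H; rewrite (_ : 4 = 2 ^+ 2) -?exprMn ?lerXn2r ?nnegrE ?mulr_ge0 ?addr_ge0 ?(ltW k0)// -natrX.
have /andP[w0 _] := cube_weight01 k.
apply: le_trans (_ : (4 ^+ d * (1 + `|t|) ^+ (2 * d) * cube_weight k) * cabs (f t) <= _).
  by rewrite ler_peMl// cabs_ge0.
rewrite (_ : _ * cabs _ = 4 ^+ d * ((1 + `|t|) ^+ (2 * d) * cabs (f t)) * cube_weight k); last by ring.
rewrite ler_wpM2r// ler_wpM2l ?exprn_ge0//.
apply: le_trans (lerD (hM t) (hN t)); rewrite -mulrDr ler_wpM2l ?exprn_ge0 ?addr_ge0//.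
by rewrite /=; case: (f t) => a b; exact: cabs_le.
Qed.

Lemma lebesgue_cube (k : 'rV[int]_d) : lebesgue_rV d (cube k : set V) = 1%E.
Proof.
pose a : V := \row_i (k ord0 i)%:~R; pose b : V := \row_i ((k ord0 i)%:~R + 1).
rewrite (_ : cube k = [set t | forall i, a ord0 i <= t ord0 i < b ord0 i]).
  rewrite lebesgue_rV_box; last by move=> i; rewrite !mxE lerDl.
  by rewrite big1// => i _; rewrite !mxE addrAC subrr add0r.
by apply/seteqP; split=> t /= H i; have := H i; rewrite !mxE.
Qed.

Lemma lebesgue_cube2 (k : 'rV[int]_d * 'rV[int]_d) :
  (lebesgue_rV d \x lebesgue_rV d)%E (cube k.1 `*` cube k.2 : set (V * V)) = 1%E.
Proof.
rewrite product_measure1E; last 2 first.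
- exact: measurable_cube.
- exact: measurable_cube.
by rewrite -[RHS]mule1; congr (_ * _)%E; exact: lebesgue_cube.
Qed.

Lemma cabs_dist (z z' : R[i]) : `|cabs z - cabs z'| <= cabs (z - z').
Proof.
have H (x y : R[i]) : cabs x - cabs y <= cabs (x - y).
  by rewrite lerBlDr; have := cabsD (x - y) y; rewrite subrK.
by rewrite ler_norml H andbT lerNl opprB cabsB H.
Qed.

Lemma schwartz_measurable (f : V -> R[i]) : schwartz f ->
  measurable_fun setT (fun t => cabs (f t)).
Proof.
move=> /schwartz_real[fR fI].
(* A dummy second variable, to fit [measurable_fun_locally_lipschitz]. *)
pose G (z : V * V) := cabs (f z.1).
have mG : measurable_fun setT G.
  apply: measurable_fun_locally_lipschitz => rho.
  have [M M0 hM] := rschwartz_lipschitz 0 (rho + rho) fR.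
  have [N N0 hN] := rschwartz_lipschitz 0 (rho + rho) fI.
  exists (M + N); rewrite ?addr_ge0// => x w x' w' xr _ x'r _.
  have xx : `|x - x'| <= rho + rho.
    by apply: le_trans (ler_normB _ _) _; exact: lerD.
  apply: le_trans (cabs_dist _ _) _.
  apply: le_trans (_ : (M + N) * `|x - x'| <= _); last first.
    by rewrite ler_wpM2l ?addr_ge0// lerDl.
  have := hM _ _ xx; have := hN _ _ xx; rewrite !expr0 !mul1r /G /= mulrDl => A B.
  apply: le_trans (lerD B A); move: (cabs_le (complex.Re (f x - f x')) (complex.Im (f x - f x'))).
  by case: (f x) (f x') => [? ?] [? ?].
exact: (measurableT_comp (f := G) (g := fun t : V => (t, 0 : V))).
Qed.

End cubes.

(** * Rudin-Shapiro polynomials and Fejer kernels *)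

Section flat_trig_poly.
Context {R : realType}.
Local Notation C := R[i].
Local Notation cabs := (@ComplexField.Normc.normc R).
Implicit Types (c : nat -> R) (r : R).

Lemma cabs_sqr (z : C) : cabs z ^+ 2 = complex.Re z ^+ 2 + complex.Im z ^+ 2.
Proof. by case: z => a b /=; rewrite sqr_sqrtr// addr_ge0 ?sqr_ge0. Qed.

Lemma trig_poly_cat m n c r : trig_poly (m + n) c r =
  trig_poly m c r + cis (2 * pi * m%:R * r) * trig_poly n (fun k => c (m + k)%N) r.
Proof.
rewrite /trig_poly big_split_ord/=; congr (_ + _); rewrite mulr_sumr.
by apply: eq_bigr => k _; rewrite mulrCA -cisD natrD; congr (_ * cis _); ring.
Qed.

Lemma eq_trig_poly n c c' r : (forall k, (k < n)%N -> c k = c' k) ->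
  trig_poly n c r = trig_poly n c' r.
Proof. by move=> cc'; apply: eq_bigr => k _; rewrite cc'. Qed.

Lemma trig_polyN n c r : trig_poly n (fun k => - c k) r = - trig_poly n c r.
Proof.
by rewrite /trig_poly -sumrN; apply: eq_bigr => k _; rewrite -mulNr rmorphN.
Qed.

Let parallelogram (z w e : C) : cabs e = 1 ->
  cabs (z + e * w) ^+ 2 + cabs (z - e * w) ^+ 2 = 2 * (cabs z ^+ 2 + cabs w ^+ 2).
Proof.
move=> e1; have -> : cabs w ^+ 2 = cabs (e * w) ^+ 2.
  by rewrite ComplexField.Normc.normcM e1 mul1r.
by rewrite !cabs_sqr; case: z (e * w) => [a b] [a' b'] /=; ring.
Qed.

(** The induction carries a companion polynomial: passing from P, Q to P + e Q, P - e Q with |e| = 1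
    doubles |P|^2 + |Q|^2, by the parallelogram law, while it doubles the length. *)
Lemma rudin_shapiro n : exists c, (forall k, `|c k| = 1) /\
  forall r, cabs (trig_poly (2 ^ n) c r) <= Num.sqrt (2 * 2 ^+ n).
Proof.
suff [c [c' [c1 c'1 H]]] : exists c c', [/\ forall k, `|c k| = 1, forall k, `|c' k| = 1 &
    forall r, cabs (trig_poly (2 ^ n) c r) ^+ 2 + cabs (trig_poly (2 ^ n) c' r) ^+ 2
      = 2 * 2 ^+ n].
  exists c; split=> // r; rewrite -[leLHS]ger0_norm ?cabs_ge0// -sqrtr_sqr.
  by rewrite ler_sqrt ?mulr_ge0 ?exprn_ge0// -(H r) lerDl sqr_ge0.
elim: n => [|n [c [c' [c1 c'1 H]]]].
  exists (fun=> 1), (fun=> 1); split=> [k|k|r]; rewrite ?normr1//.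
  by rewrite /trig_poly !big_ord1 !mulr0 mul0r cis0 mulr1 cabs_real normr1; ring.
pose m := (2 ^ n)%N.
pose a k := if (k < m)%N then c k else c' (k - m)%N.
pose b k := if (k < m)%N then c k else - c' (k - m)%N.
have aE r : trig_poly (m + m) a r =
    trig_poly m c r + cis (2 * pi * m%:R * r) * trig_poly m c' r.
  rewrite trig_poly_cat; congr (_ + _ * _).
    by apply: eq_trig_poly => k km; rewrite /a km.
  by apply: eq_trig_poly => k _; rewrite /a ltnNge leq_addr addKn.
have bE r : trig_poly (m + m) b r =
    trig_poly m c r - cis (2 * pi * m%:R * r) * trig_poly m c' r.
  rewrite trig_poly_cat -mulrN -trig_polyN; congr (_ + _ * _).
    by apply: eq_trig_poly => k km; rewrite /b km.
  by apply: eq_trig_poly => k _; rewrite /b ltnNge leq_addr addKn.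
exists a, b; split.
- by move=> k; rewrite /a; case: ifP.
- by move=> k; rewrite /b; case: ifP; rewrite ?normrN.
move=> r; rewrite expnS mul2n -addnn -/m aE bE parallelogram ?cabs_cis//.
by rewrite H exprS.
Qed.

Definition dirichlet n r : C := trig_poly n (fun=> 1) r.

Lemma cabs_dirichlet_le n r : cabs (dirichlet n r) <= n%:R.
Proof.
apply: le_trans (cabs_sum _ _ _) _.
rewrite -[X in _ <= X%:R](card_ord n) -sumr_const; apply: ler_sum => k _.
by rewrite ComplexField.Normc.normcM cabs_real normr1 mul1r cabs_cis.
Qed.

Lemma cabs_dirichlet_sqr n r : cabs (dirichlet n r) ^+ 2 =
  \sum_(i < n) \sum_(j < n) cos (2 * pi * (i%:R - j%:R) * r).
Proof.
have -> : dirichlet n r = \sum_(k < n) cis (2 * pi * k%:R * r).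
  by apply: eq_bigr => k _; rewrite mul1r.
rewrite cabs_sqr.
have ReE : complex.Re (\sum_(k < n) cis (2 * pi * k%:R * r)) =
    \sum_(k < n) cos (2 * pi * k%:R * r).
  by apply: (big_morph (@complex.Re R)) => // -[? ?] [? ?].
have ImE : complex.Im (\sum_(k < n) cis (2 * pi * k%:R * r)) =
    \sum_(k < n) sin (2 * pi * k%:R * r).
  by apply: (big_morph (@complex.Im R)) => // -[? ?] [? ?].
rewrite ReE ImE !expr2 !mulr_suml -big_split/=; apply: eq_bigr => i _.
rewrite !mulr_sumr -big_split/=; apply: eq_bigr => j _.
by rewrite -cosB; congr cos; ring.
Qed.

(* The coefficients of the shifted Fejer kernel [D ^ 2 / n], [D] being the
   Dirichlet kernel. *)
Definition fejer_coef n k : R :=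
  n%:R^-1 * \sum_(i < n) \sum_(j < n) (i + j == k)%N%:R.

(** The square of the Dirichlet kernel D, unlike |D|^2, has only nonnegative frequencies, as
    [trig_poly] requires, and the modulus of D^2 / n is the Fejer kernel. The frequencies i + j with
    i, j < n stay below n + n. *)
Lemma fejer_trig_poly n r :
  trig_poly (n + n) (fejer_coef n) r = (n%:R^-1)%:C%C * dirichlet n r ^+ 2.
Proof.
pose z k : C := cis (2 * pi * k%:R * r).
have DE : dirichlet n r = \sum_(k < n) z k.
  by apply: eq_bigr => k _; rewrite mul1r.
have cE k : ((fejer_coef n k)%:C)%C =
    (n%:R^-1)%:C%C * \sum_(i < n) \sum_(j < n) ((i + j == k)%N%:R : C).
  rewrite /fejer_coef rmorphM rmorph_sum; congr (_ * _); apply: eq_bigr => i _.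
  by rewrite rmorph_sum; apply: eq_bigr => j _; rewrite rmorph_nat.
have -> : trig_poly (n + n) (fejer_coef n) r = (n%:R^-1)%:C%C *
    \sum_(k < n + n) \sum_(i < n) \sum_(j < n) ((i + j == k)%N%:R * z k).
  rewrite mulr_sumr; apply: eq_bigr => k _; rewrite cE -mulrA; congr (_ * _).
  by rewrite mulr_suml; apply: eq_bigr => i _; rewrite mulr_suml.
rewrite DE expr2; congr (_ * _).
rewrite mulr_suml exchange_big; apply: eq_bigr => i _.
rewrite mulr_sumr exchange_big; apply: eq_bigr => j _.
have ij : (i + j < n + n)%N.
  by apply: leq_trans (_ : i + n <= _)%N; rewrite ?ltn_add2l// leq_add2r ltnW.
rewrite (bigD1 (Ordinal ij))//= eqxx big1 ?addr0.
  by rewrite /z mul1r natrD -cisD; congr cis; ring.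
by move=> k; rewrite eq_sym -val_eqE /= => /negbTE ->; rewrite mul0r.
Qed.

Lemma fejer_coef_ge0 n k : 0 <= fejer_coef n k.
Proof. by rewrite mulr_ge0// sumr_ge0// => i _; rewrite sumr_ge0. Qed.

Let inner_le1 n (i k : nat) : \sum_(j < n) (i + j == k)%N%:R <= 1 :> R.
Proof.
have [ij|H] := boolP [exists j : 'I_n, i + j == k]%N.
  have /existsP[j /eqP jE] := ij.
  rewrite (bigD1 j)//= jE eqxx big1 ?addr0// => j' j'j.
  by rewrite -jE eqn_add2l val_eqE (negbTE j'j).
rewrite big1// => j _; move: H; rewrite negb_exists => /forallP/(_ j).
by move=> /negbTE ->.
Qed.

Lemma fejer_coef_le1 n k : fejer_coef n k <= 1.
Proof.
have [->|n0] := posnP n; first by rewrite /fejer_coef invr0 mul0r.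
rewrite /fejer_coef mulrC ler_pdivrMr ?ltr0n// mul1r.
rewrite -[X in _ <= X%:R](card_ord n) -sumr_const; apply: ler_sum => i _.
exact: inner_le1.
Qed.

(** Every i <= k has the partner j = k - i, so that at least k + 1 pairs sum to k, and n <= 2 k
    makes k + 1 at least n / 2. *)
Lemma fejer_coef_ge n k : (k < n)%N -> (n <= k.*2)%N -> 2^-1 <= fejer_coef n k.
Proof.
move=> kn nk; have n0 : 0 < n%:R :> R by rewrite ltr0n (leq_ltn_trans _ kn).
rewrite /fejer_coef mulrC ler_pdivlMr//.
apply: le_trans (_ : \sum_(i < n) (i <= k)%N%:R <= _).
  rewrite -(big_mkord xpredT (fun i => (i <= k)%N%:R)) (big_cat_nat _ (n := k.+1))//=.
  rewrite big_nat (eq_bigr (fun=> 1)); last first.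
    by move=> i /andP[_]; rewrite ltnS => ->.
  rewrite -big_nat sumr_const_nat subn0.
  apply: le_trans (_ : k.+1%:R <= _); last first.
    by rewrite lerDl sumr_ge0.
  rewrite mulrC ler_pdivrMr// -natrM ler_nat muln2.
  by apply: leq_trans nk _; rewrite leq_double.
apply: ler_sum => i _; case: (leqP i k) => ik; last by rewrite sumr_ge0.
have jn : (k - i < n)%N by apply: leq_ltn_trans kn; exact: leq_subr.
by rewrite (bigD1 (Ordinal jn))//= subnKC// eqxx lerDl sumr_ge0.
Qed.

Lemma cis_int (m : int) : cis (2 * pi * m%:~R) = 1 :> C.
Proof.
have cn (n : nat) : cis (2 * pi * n%:R) = 1 :> C.
  elim: n => [|n IH]; first by rewrite mulr0 cis0.
  have -> : 2 * pi * n.+1%:R = 2 * pi * n%:R + pi *+ 2 :> R by rewrite -natr1; ring.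
  by rewrite cisD IH mul1r /cis cos2pi sin2pi.
case: m => n; first exact: cn.
rewrite NegzE mulrNz mulrN -cisN [X in X^*%C](cn n.+1).
exact: conjc1.
Qed.

(** A primitive of cos (b x); b = 0 occurs for the diagonal terms of the expanded square. *)
Let prim (b x : R) := if b == 0 then x else sin (b * x) / b.

Let is_derive_prim (b x : R) : is_derive x 1 (prim b) (cos (b * x)).
Proof.
rewrite /prim; have [->|b0] := eqVneq b 0.
  by rewrite mul0r cos0; exact: is_derive_id.
rewrite (_ : (fun x => _) = (b^-1 *: (sin \o (fun x => b *: (x : R^o))))); last first.
  by apply/funext => y /=; rewrite mulrC.
apply: is_derive_eq; rewrite /=.
by rewrite -![_ *: _]/(_ * _) mulr1 [X in b^-1 * X]mulrC mulKf.
Qed.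

(** Orthogonality over a unit interval: off the diagonal (i - j) L is a nonzero integer, so the
    primitive has equal values at both ends; each of the n diagonal terms contributes 1. *)
Lemma integral_dirichlet n (L : nat) (a : int) : (0 < n)%N -> (0 < L)%N ->
  (\int[lebesgue_measure]_(x in `[a%:~R, (a%:~R + 1)%R[)
    (n%:R^-1 * cabs (dirichlet n (L%:R * x)) ^+ 2)%:E <= 1)%E.
Proof.
move=> n0 L0.
pose b (i j : 'I_n) : R := 2 * pi * (i%:R - j%:R) * L%:R.
pose f (x : R) : R := n%:R^-1 * \sum_(i < n) \sum_(j < n) cos (b i j * x).
have fE x : n%:R^-1 * cabs (dirichlet n (L%:R * x)) ^+ 2 = f x.
  rewrite cabs_dirichlet_sqr /f; congr (_ * _); apply: eq_bigr => i _.
  by apply: eq_bigr => j _; rewrite mulrA.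
have f0 x : 0 <= f x by rewrite -fE mulr_ge0// sqr_ge0.
pose F : R -> R := n%:R^-1 *: \sum_(i < n) \sum_(j < n) prim (b i j).
have dF (x : R) : is_derive x 1 F (f x).
  have d1 : is_derive x 1 (\sum_(i < n) \sum_(j < n) prim (b i j))
      (\sum_(i < n) \sum_(j < n) cos (b i j * x)).
    by apply: is_derive_sum => i; apply: is_derive_sum => j; exact: is_derive_prim.
  exact: is_deriveZ.
have cF : continuous F.
  by move=> x; apply/differentiable_continuous/derivable1_diffP; have [] := dF x.
have cf : continuous f.
  have dc (c x : R) : is_derive x 1 (fun y : R => cos (c * y)) (- (c * sin (c * x))).
    rewrite (_ : (fun y => _) = cos \o (fun y => c *: (y : R^o)))//.
    by apply: is_derive_eq; rewrite -![_ *: _]/(_ * _) /=; ring.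
  have fE2 : f = n%:R^-1 *: \sum_(i < n) \sum_(j < n) (fun x => cos (b i j * x)).
    apply/funext => x; rewrite /f /= -[RHS]/(_ * _) fct_sumE; congr (_ * _).
    by apply: eq_bigr => i _; rewrite fct_sumE.
  move=> x; rewrite fE2; apply/differentiable_continuous/derivable1_diffP.
  apply: derivableZ; apply: derivable_sum => i; apply: derivable_sum => j.
  by have [] := dc (b i j) x.
under eq_integral do rewrite fE.
apply: le_trans (_ : \int[lebesgue_measure]_(x in `[a%:~R, (a%:~R + 1)%R]) (f x)%:E <= _)%E.
  apply: ge0_subset_integral => //.
  - apply/measurable_EFinP/measurable_funTS; exact: continuous_measurable_fun.
  - by move=> x _; rewrite lee_fin.
  - by move=> x; rewrite /= !in_itv/= => /andP[ax /ltW xa]; apply/andP.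
rewrite (@continuous_FTC2 _ f F); last first.
- by move=> x _; rewrite derive1E; have [_ ->] := dF x.
- split.
  + by move=> x _; have [] := dF x.
  + exact/cvg_at_right_filter/cF.
  + exact/cvg_at_left_filter/cF.
- exact: continuous_subspaceT.
- by rewrite ltrDl.
have FE x : F x = n%:R^-1 * \sum_(i < n) \sum_(j < n) prim (b i j) x.
  rewrite /F -[LHS]/(_ * _) fct_sumE; congr (_ * _).
  by apply: eq_bigr => i _; rewrite fct_sumE.
rewrite -EFinB lee_fin !FE -mulrBr -sumrB.
rewrite (eq_bigr (fun=> 1)) => [|i _].
  by rewrite sumr_const card_ord mulVf// pnatr_eq0 -lt0n.
rewrite -sumrB (bigD1 i)//= big1 ?addr0 => [|j ji].
  by rewrite /b subrr mulr0 mul0r /prim eqxx addrC addKr.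
have bij0 : b i j != 0.
  rewrite !mulf_neq0 ?pnatr_eq0 -?lt0n//; first by rewrite gt_eqF// pi_gt0.
  by rewrite subr_eq0 eqr_nat eq_sym.
rewrite /prim (negbTE bij0) -mulrBl.
pose m : int := ((i : nat)%:Z - (j : nat)%:Z) * L%:Z.
have bm : b i j = 2 * pi * m%:~R.
  by rewrite /b /m rmorphM rmorphB /= !pmulrn; ring.
have [cb sb] : cos (b i j) = 1 /\ sin (b i j) = 0.
  by have := cis_int m; rewrite -bm /cis => -[-> ->].
by rewrite mulrDr mulr1 sinD cb sb mulr1 mulr0 addr0 subrr mul0r.
Qed.

End flat_trig_poly.

(** * Integration over cubes *)

Section integrals.
Context {R : realType}.

Lemma ge0_integral_translation n (x : 'rV[R]_n) (f : 'rV[R]_n -> \bar R) :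
  measurable_fun setT f -> (forall t, 0 <= f t)%E ->
  (\int[lebesgue_rV n]_t f (t + x)%R = \int[lebesgue_rV n]_t f t)%E.
Proof.
move=> mf f0; have mx := measurable_addr_rV x.
pose m : {measure set 'rV[R]_n -> \bar R} :=
  measure_function_pushforward__canonical__measure_function_Measure
    (lebesgue_rV n) mx.
have mE A : measurable A -> A `<=` setT -> m A = lebesgue_rV n A.
  by move=> mA _; rewrite -[RHS](lebesgue_rV_translation x).
rewrite -[RHS](eq_measure_integral (lebesgue_rV n) mE).
by rewrite /m ge0_integral_pushforward.
Qed.

Lemma ge0_integral_translation2 n (x : 'rV[R]_n) (f : 'rV[R]_n * 'rV[R]_n -> \bar R) :
  measurable_fun setT f -> (forall z, 0 <= f z)%E ->
  (\int[lebesgue_rV n \x lebesgue_rV n]_z f (z.1, z.2 + x)%R =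
   \int[lebesgue_rV n \x lebesgue_rV n]_z f z)%E.
Proof.
move=> mf f0.
have ms : measurable_fun setT (fun z : 'rV[R]_n * 'rV[R]_n => (z.1, z.2 + x)).
  apply/measurable_fun_pairP; split; first exact: measurable_fst.
  exact: (measurableT_comp (measurable_addr_rV x) measurable_snd).
rewrite fubini_tonelli1//; last exact: (measurableT_comp mf ms).
rewrite fubini_tonelli1//; apply: eq_integral => y _.
rewrite /fubini_F /= (ge0_integral_translation x (f := fun w => f (y, w)))//.
exact: (measurableT_comp mf (measurable_pair1 y)).
Qed.

Definition intr_rV n (m : 'rV[int]_n) : 'rV[R]_n := \row_i (m ord0 i)%:~R.

(** Translation invariance in the second variable; since [m] is integral, the translate of a cube is
    again a cube. *)
Lemma integral_cube_translation n (f : 'rV[R]_n * 'rV[R]_n -> R)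
  (k l m : 'rV[int]_n) : measurable_fun setT f -> (forall z, 0 <= f z) ->
  (\int[lebesgue_rV n \x lebesgue_rV n]_(z in cube k `*` cube l)
     (f (z.1, z.2 - intr_rV m))%:E =
   \int[lebesgue_rV n \x lebesgue_rV n]_(z in cube k `*` cube (l - m)) (f z)%:E)%E.
Proof.
move=> mf f0.
have mQ j j' : measurable (cube j `*` cube j' : set ('rV[R]_n * 'rV[R]_n)).
  by apply: measurableX; exact: measurable_cube.
rewrite [LHS]integral_mul_indic// [RHS]integral_mul_indic//.
rewrite -[RHS](ge0_integral_translation2 (- intr_rV m)); last 2 first.
- by apply/measurable_EFinP; apply: measurable_funM.
- by move=> z; rewrite lee_fin mulr_ge0.
apply: eq_integral => -[x w] _; congr (_ * _)%:E; rewrite !indicE; congr (_%:R).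
congr nat_of_bool.
apply/idP/idP; rewrite !inE /= => -[kx lw]; split=> // i; have := lw i; rewrite !mxE.
  by move=> /andP[a b]; rewrite intrD rmorphN; apply/andP; split; lra.
by rewrite intrD rmorphN => /andP[a b]; apply/andP; split; lra.
Qed.

(** The first coordinate is the factor split off by [cons_rV]; the others range over a unit cube and
    integrate to 1. *)
Lemma integral_cube_coord n (k : 'rV[int]_n.+1) (h : R -> R) :
  measurable_fun setT h -> (forall x, 0 <= h x) ->
  (\int[lebesgue_rV n.+1]_(t in cube k) (h (t ord0 ord0))%:E =
   \int[lebesgue_measure]_(x in `[(k ord0 ord0)%:~R, ((k ord0 ord0)%:~R + 1)%R[)
     (h x)%:E)%E.
Proof.
move=> mh h0.
pose tl : 'rV[int]_n := \row_i k ord0 (lift ord0 i).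
pose I : set R := `[(k ord0 ord0)%:~R, ((k ord0 ord0)%:~R + 1)%R[%classic.
have mI : measurable I by exact: measurable_itv.
have mh' : measurable_fun [set: 'rV[R]_n.+1] (fun t => h (t ord0 ord0)).
  exact: (measurableT_comp mh (measurable_rV_coord ord0)).
rewrite [LHS]integral_mul_indic// [RHS]integral_mul_indic//.
rewrite -[LHS]/(\int[pushforward (lebesgue_measure \x lebesgue_rV n)%E (@cons_rV R n)]_t
  (h (t ord0 ord0) * \1_(cube k) t)%:E)%E.
rewrite ge0_integral_pushforward//=; last 3 first.
- exact: measurable_cons_rV.
- apply/measurable_EFinP; apply: measurable_funM => //; apply: measurable_indic.
  exact: measurable_cube.
- by move=> t _; rewrite lee_fin mulr_ge0.
rewrite preimage_setT.
have E (z : R * 'rV[R]_n) : h ((cons_rV z) ord0 ord0) * \1_(cube k) (cons_rV z) =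
    h z.1 * \1_I z.1 * \1_(cube tl) z.2.
  rewrite cons_rV0 -mulrA; congr (_ * _); rewrite !indicE -natrM mulnb.
  congr (_%:R); congr nat_of_bool; apply/idP/andP; rewrite !inE /=.
    move=> H; split; first by have := H ord0; rewrite cons_rV0 /I /= in_itv.
    by move=> i; have := H (lift ord0 i); rewrite cons_rVS !mxE.
  move=> [H1 H2] i; have [j ->|->] := unliftP ord0 i.
    by have := H2 j; rewrite cons_rVS !mxE.
  by move: H1; rewrite cons_rV0 /I /= in_itv.
under eq_integral do rewrite E.
have mE : measurable_fun setT (fun z : measurableTypeR R * 'rV[R]_n =>
    (h z.1 * \1_I z.1 * \1_(cube tl) z.2)%:E).
  apply/measurable_EFinP; apply: measurable_funM.
    apply: measurable_funM; first exact: (measurableT_comp mh measurable_fst).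
    exact: (measurableT_comp (measurable_indic mI) measurable_fst).
  exact: (measurableT_comp (measurable_indic (measurable_cube tl)) measurable_snd).
rewrite fubini_tonelli1//; last by move=> z; rewrite lee_fin !mulr_ge0.
apply: eq_integral => x _; rewrite /fubini_F /=.
under eq_integral do rewrite EFinM.
rewrite ge0_integralZl//; last 2 first.
- by apply/measurable_EFinP; apply: measurable_indic; exact: measurable_cube.
- by rewrite lee_fin mulr_ge0.
rewrite integral_indic//; last exact: measurable_cube.
rewrite setIT -[RHS]mule1; congr (_ * _)%E; exact: lebesgue_cube.
Qed.

Lemma measurable_dirichlet_sqr n : measurable_fun setT
  (fun x : R => ComplexField.Normc.normc (dirichlet n x : R[i]) ^+ 2).
Proof.
rewrite (_ : (fun x => _) = (fun x =>
  \sum_(i < n) \sum_(j < n) cos (2 * pi * (i%:R - j%:R) * x))); last first.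
  by apply/funext => x; rewrite -cabs_dirichlet_sqr.
apply: measurable_sum => i; apply: measurable_sum => j.
apply: continuous_measurable_fun => x.
apply: (@continuous_comp _ _ _ (fun y => 2 * pi * (i%:R - j%:R) * y) cos).
  exact: mulrl_continuous.
exact: continuous_cos.
Qed.

Lemma measurable_fejer N (L : nat) : measurable_fun setT (fun x : R => N%:R^-1 *
  ComplexField.Normc.normc (dirichlet N (L%:R * x) : R[i]) ^+ 2).
Proof.
apply: measurable_funM => //.
apply: (measurableT_comp (measurable_dirichlet_sqr N)).
exact: measurable_funM.
Qed.

Lemma integral_fejer_cube n N (L : nat) (k : 'rV[int]_n.+1) : (0 < N)%N -> (0 < L)%N ->
  (\int[lebesgue_rV n.+1]_(t in cube k) (N%:R^-1 *
    ComplexField.Normc.normc (dirichlet N (L%:R * t ord0 ord0) : R[i]) ^+ 2)%:E <= 1)%E.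
Proof.
move=> N0 L0.
rewrite (integral_cube_coord k (h := fun x => N%:R^-1 *
  ComplexField.Normc.normc (dirichlet N (L%:R * x) : R[i]) ^+ 2)).
- exact: integral_dirichlet.
- exact: measurable_fejer.
- by move=> x; rewrite mulr_ge0// sqr_ge0.
Qed.

End integrals.

(** * Lower bounds for short-time Fourier transforms *)

Section stft_lower_bound.
Context {R : realType} {n : nat}.
Local Notation V := 'rV[R]_n.+1.
Local Notation C := R[i].
Local Notation cabs := (@ComplexField.Normc.normc R).
Local Notation lebesgue2 := (lebesgue_rV n.+1 \x lebesgue_rV n.+1)%E.
Variable u : (V -> C) -> C.
Hypothesis tu : tempered_distribution u.

Lemma measurable_stft_distribution f : schwartz f ->
  measurable_fun setT (fun z : V * V => cabs (stft_distribution u f z)).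
Proof.
move=> Sf; apply: measurable_fun_locally_lipschitz => rho.
have [M M0 HM] := stft_distribution_lipschitz (ltn0Sn n) tu rho Sf.
exists M => // x w x' w' xr wr x'r w'r.
by apply: le_trans (cabs_dist _ _) _; exact: HM.
Qed.

Definition axis (m : int) : 'rV[int]_n.+1 := \row_j (if j == ord0 then m else 0).

Lemma axis_inj : injective axis.
Proof. by move=> a b /rowP/(_ ord0); rewrite !mxE eqxx. Qed.

Lemma axisB a b : axis a - axis b = axis (a - b).
Proof. by apply/rowP => j; rewrite !mxE; case: ifP => //; rewrite subr0. Qed.

Lemma intr_rV_axis (m : nat) : intr_rV (axis m) = m%:R *: delta_mx ord0 ord0 :> V.
Proof.
by apply/rowP => j; rewrite !mxE eqxx /=; case: eqP => _; rewrite ?mulr1 ?mulr0.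
Qed.

Let Q (k : 'rV[int]_n.+1 * 'rV[int]_n.+1) : set (V * V) := cube k.1 `*` cube k.2.

(** The lower bounds use only cubes with time index 0 and frequency index on the first axis, along
    which the translates of a modulated function line up. *)
Definition cell (l : int) : 'rV[int]_n.+1 * 'rV[int]_n.+1 := (0, axis l).

Lemma cell_inj : injective cell.
Proof. by move=> a b [/axis_inj]. Qed.

Let mQ k : measurable (Q k).
Proof. by apply: measurableX; exact: measurable_cube. Qed.

Let lebesgueQ k : lebesgue2 (Q k) = 1%E. Proof. exact: lebesgue_cube2. Qed.

(** The origin is a corner of the cube: on a small box at this corner the Lipschitz bound keeps |F|
    at least half its value at the origin. *)
Lemma integral_stft_gt0 f : schwartz f -> stft_distribution u f (0, 0) <> 0 ->
  exists2 b : R, 0 < b &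
    (b%:E <= \int[lebesgue2]_(z in Q (cell 0%R)) (cabs (stft_distribution u f z))%:E)%E.
Proof.
move=> Sf F0; set F := stft_distribution u f.
have c0 : 0 < cabs (F (0, 0)).
  rewrite lt_neqAle cabs_ge0 andbT eq_sym; apply/eqP => /ComplexField.Normc.eq0_normc.
  exact: F0.
set c := cabs _ in c0.
have [M M0 HM] := stft_distribution_lipschitz (ltn0Sn n) tu 1 Sf.
(* M (dl + dl) bounds the variation of F on the box; the choice has M + 1 in the denominator since
   [M] may vanish. *)
have [dl [dl0 dl1 dlM]] : exists dl : R, [/\ 0 < dl, dl <= 1 & M * (dl + dl) <= c / 2].
  have q0 : 0 < c / (4 * (M + 1)) by rewrite divr_gt0// mulr_gt0// ltr_wpDl.
  exists (Num.min 1 (c / (4 * (M + 1)))); split.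
  - by rewrite lt_min ltr01.
  - by rewrite ge_min lexx.
  set dl := Num.min _ _.
  have : dl <= c / (4 * (M + 1)) by rewrite /dl ge_min lexx orbT.
  rewrite ler_pdivlMr ?mulr_gt0// ?ltr_wpDl// => H.
  have : 0 <= dl by rewrite /dl le_min ler01 ltW.
  by rewrite ler_pdivlMr//; nra.
pose box : set V := [set t | forall i, 0 <= t ord0 i < dl].
have mbox : measurable box.
  pose P (i : 'I_n.+1) : set R := `[0, dl[%classic.
  rewrite (_ : box = [set v | forall i, P i (v ord0 i)]).
    by apply: measurable_rV_forall => i; exact: measurable_itv.
  by apply/seteqP; split=> v /= H i; have := H i; rewrite /P /= in_itv.
have lbox : lebesgue_rV n.+1 box = (dl ^+ n.+1)%:E.
  rewrite (_ : box = [set t | forall i, (0 : V) ord0 i <= t ord0 i < (const_mx dl : V) ord0 i]).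
    rewrite lebesgue_rV_box; last by move=> i; rewrite !mxE ltW.
    rewrite (eq_bigr (fun=> dl)) ?prodr_const ?card_ord// => i _.
    by rewrite !mxE subr0.
  by apply/seteqP; split=> t /= H i; have := H i; rewrite !mxE.
have lbox2 : lebesgue2 (box `*` box) = (dl ^+ n.+1 * dl ^+ n.+1)%:E.
  apply: etrans (product_measure1E _ _ mbox mbox) _.
  by rewrite EFinM -lbox.
have box_norm t : box t -> `|t| <= dl.
  move=> tb; rewrite [leLHS](@mx_normrE R 1 n.+1); apply/bigmax_leP; split; first exact: ltW.
  move=> [a i] _ /=; rewrite ord1; have /andP[t0 td] := tb i.
  by rewrite ger0_norm// ltW.
have box_cube t : box t -> cube 0 t.
  move=> tb i; have /andP[t0 td] := tb i.
  by rewrite mxE t0 add0r (lt_le_trans td).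
have axis0 : axis 0 = 0 by apply/rowP => j; rewrite !mxE if_same.
exists (c / 2 * (dl ^+ n.+1 * dl ^+ n.+1)).
  by rewrite !mulr_gt0 ?exprn_gt0.
apply: le_trans (_ : \int[lebesgue2]_(z in box `*` box) (cabs (F z))%:E <= _)%E; last first.
  apply: ge0_subset_integral => //.
  - exact: measurableX.
  - apply/measurable_EFinP/measurable_funTS; exact: measurable_stft_distribution.
  - by move=> z _; rewrite lee_fin cabs_ge0.
  - by move=> [x w] /= [xb wb]; split=> /=; rewrite ?axis0; exact: box_cube.
apply: le_trans (_ : \int[lebesgue2]_(z in box `*` box) (cst (c / 2)%:E z) <= _)%E.
  rewrite integral_cst; last exact: measurableX.
  rewrite EFinM -lbox2; exact: lexx.
apply: ge0_le_integral => //.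
- exact: measurableX.
- by move=> z _; rewrite lee_fin divr_ge0// ltW.
- apply/measurable_EFinP/measurable_funTS; exact: measurable_stft_distribution.
move=> [x w] [/= /box_norm xb /box_norm wb]; rewrite lee_fin.
have x1 := le_trans xb dl1; have w1 := le_trans wb dl1.
have := HM 0 0 x w; rewrite !normr0 => /(_ ler01 ler01 x1 w1).
rewrite !sub0r !normrN => H.
have : cabs (F (0, 0) - F (x, w)) <= c / 2.
  apply: le_trans H (le_trans _ dlM); by rewrite ler_wpM2l// lerD.
have := cabs_dist (F (0, 0)) (F (x, w)); rewrite -/c => H1 H2.
have := le_trans (ler_norm _) (le_trans H1 H2); lra.
Qed.

Variables (p : \bar R) (r : R).
Hypotheses (p1 : (1 <= p)%E) (r1 : 1 <= r).

Lemma integral_stft_tail f (e : R) : schwartz f -> 0 < e ->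
  (wiener_norm2 p r%:E (stft_distribution u f) < +oo)%E ->
  exists2 L : nat, (0 < L)%N & forall l : int, (L <= `|l|)%N ->
  (\int[lebesgue2]_(z in Q (cell l)) (cabs (stft_distribution u f z))%:E < e%:E)%E.
Proof.
move=> Sf e0 Foo.
(* [amalgam_norm_tail] works along a sequence of cubes, so the two half-axes are treated
   separately. *)
have i1 : injective (fun m : nat => cell m%:Z).
  by move=> a b /cell_inj[].
have i2 : injective (fun m : nat => cell (- m%:Z)).
  by move=> a b /cell_inj/oppr_inj[].
have [L1 H1] := amalgam_norm_tail r1 i1 e0 Foo.
have [L2 H2] := amalgam_norm_tail r1 i2 e0 Foo.
exists (maxn L1 L2).+1 => // l Ll.
have LN : forall k, (\int[lebesgue2]_(z in Q k) (cabs (stft_distribution u f z))%:E <=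
  Lnorm lebesgue2 p (fun t => (cabs (stft_distribution u f t) * \1_(Q k) t)%:E))%E.
  move=> k; apply: (@L1_le_Lnorm _ _ _ _ _ (mQ k) (lebesgueQ k) _ p
    (measurable_stft_distribution Sf)) => // z.
  exact: cabs_ge0.
apply: le_lt_trans (LN _) _.
have [l0|l0] := leP 0 l.
  have -> : l = `|l|%N by rewrite gez0_abs.
  by apply: H1; apply: leq_trans Ll; rewrite ltnW// ltnS leq_maxl.
have -> : l = - (`|l|%N)%:Z by rewrite ltz0_abs// opprK.
by apply: H2; apply: leq_trans Ll; rewrite ltnW// ltnS leq_maxr.
Qed.

(* The summands of [stft_modulate] are translates of [V_u f] by multiples of
   [L]; since [V_u f] is small in mean on far cubes, they do not interact on
   the cubes [J j * L] when [L] is large. *)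
Lemma wiener_norm2_stft_modulate f : schwartz f -> stft_distribution u f (0, 0) <> 0 ->
  (wiener_norm2 p r%:E (stft_distribution u f) < +oo)%E ->
  exists2 b : R, 0 < b & forall N (c : nat -> R), (forall k, `|c k| <= 1) ->
  exists2 L : nat, (0 < L)%N & forall m (J : 'I_m -> 'I_N), injective J ->
    (forall j, 2^-1 <= `|c (J j)|) ->
    ((m%:R `^ r^-1 * b)%:E <=
      wiener_norm2 p r%:E (stft_distribution u (modulate N c L ord0 f)))%E.
Proof.
move=> Sf F0 Foo; have [b b0 bB] := integral_stft_gt0 Sf F0.
exists (b / 4); first by rewrite divr_gt0.
move=> N c c1.
(* At most [N] unwanted terms, each below [e] in mean, add up to at most b / 4; N + 1 avoids a
   division by 0. *)
pose e := b / 4 / N.+1%:R.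
have e0 : 0 < e by rewrite !divr_gt0.
have [L L0 LP] := integral_stft_tail Sf e0 Foo.
exists L => // m J Jinj Jc.
set F := stft_distribution u f in F0 Foo bB LP.
set W := stft_distribution u _.
have mW : measurable_fun setT (fun z => cabs (W z)).
  by apply: measurable_stft_distribution; exact: modulate_schwartz.
apply: (@amalgam_norm_ge _ _ _ _ _ _ _ _ _ r1 m
  (fun j => cell ((J j : nat) * L)%N%:Z)).
- move=> i j /cell_inj [] /eqP; rewrite eqn_pmul2r// => /eqP ij.
  by apply: Jinj; exact: val_inj.
- by rewrite divr_ge0// ltW.
move=> j; apply: le_trans (_ : _ <= \int[lebesgue2]_(z in Q (cell ((J j : nat) * L)%N%:Z)) (cabs (W z))%:E)%E _; last first.
  apply: (@L1_le_Lnorm _ _ _ _ _ (mQ _) (lebesgueQ _) _ p mW) => // z.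
  exact: cabs_ge0.
set D := Q _.
pose h (k : 'I_N) z := cabs (F (z.1, z.2 - intr_rV (axis ((k : nat) * L)%N%:Z))).
have h0 k z : 0 <= h k z by exact: cabs_ge0.
have mh k : measurable_fun setT (h k).
  apply: (measurableT_comp (f := fun z => cabs (F z))
    (g := fun z : V * V => (z.1, z.2 - intr_rV (axis ((k : nat) * L)%N%:Z)))).
    exact: measurable_stft_distribution.
  apply/measurable_fun_pairP; split; first exact: measurable_fst.
  exact: (measurableT_comp (measurable_addr_rV _) measurable_snd).
have ih k : (\int[lebesgue2]_(z in D) (h k z)%:E =
    \int[lebesgue2]_(z in Q (cell ((J j * L)%N%:Z - (k * L)%N%:Z)%R)) (cabs (F z))%:E)%E.
  rewrite /D /Q /= -axisB.
  apply: (integral_cube_translation (f := fun z => cabs (F z))).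
    exact: measurable_stft_distribution.
  by move=> z; exact: cabs_ge0.
(* The term k = J j is set to 0 instead of being removed, so that the sum still runs over all of
   ['I_N]. *)
pose g k z := if k == J j then 0 else h k z.
have mg k : measurable_fun setT (g k) by rewrite /g; case: eqP.
have g0 k z : 0 <= g k z by rewrite /g; case: eqP.
have ptw z : 2^-1 * h (J j) z <= cabs (W z) + \sum_(k < N) g k z.
  apply: le_trans (_ : `|c (J j)| * h (J j) z <= _); first by rewrite ler_wpM2r.
  have WE : W z = \sum_(k < N) (c k)%:C%C * F (z.1, z.2 - intr_rV (axis ((k : nat) * L)%N%:Z)).
    rewrite /W; case: z => x w; rewrite stft_modulate//.
    by apply: eq_bigr => k _; rewrite intr_rV_axis.
  rewrite /h -cabs_real -ComplexField.Normc.normcM.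
  rewrite (_ : _ * F _ = W z - \sum_(k < N | k != J j) (c k)%:C%C *
    F (z.1, z.2 - intr_rV (axis ((k : nat) * L)%N%:Z))); last first.
    by rewrite WE (bigD1 (J j))//= addrK.
  apply: le_trans (cabsD _ _) _; rewrite lerD2l cabsN.
  apply: le_trans (cabs_sum _ _ _) _.
  rewrite [leRHS](bigID (fun k => k == J j))/= [X in _ <= X + _]big1 ?add0r; last first.
    by move=> k /eqP ->; rewrite /g eqxx.
  apply: ler_sum => k /negbTE kJ; rewrite /g kJ ComplexField.Normc.normcM cabs_real.
  by rewrite ler_piMl// cabs_ge0.
have mD : measurable D by exact: mQ.
have : (\int[lebesgue2]_(z in D) (2^-1 * h (J j) z)%:E <=
    \int[lebesgue2]_(z in D) ((cabs (W z))%:E + \sum_(k < N) (g k z)%:E))%E.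
  apply: ge0_le_integral => //.
  - by move=> z _; rewrite lee_fin mulr_ge0.
  - by apply/measurable_EFinP/measurable_funTS/measurable_funM.
  - apply: emeasurable_funD; first exact/measurable_EFinP/measurable_funTS.
    by apply: emeasurable_sum => k; exact/measurable_EFinP/measurable_funTS.
  - by move=> z _; rewrite sumEFin -EFinD lee_fin.
rewrite ge0_integralD//; last 4 first.
- by move=> z _; rewrite lee_fin cabs_ge0.
- exact/measurable_EFinP/measurable_funTS.
- by move=> z _; apply: sume_ge0 => k _; rewrite lee_fin.
- by apply: emeasurable_sum => k; exact/measurable_EFinP/measurable_funTS.
rewrite ge0_integral_sum//; last 2 first.
- by move=> k; exact/measurable_EFinP/measurable_funTS.
- by move=> k z _; rewrite lee_fin.
have -> : (\int[lebesgue2]_(z in D) (2^-1 * h (J j) z)%:E =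
    2^-1%:E * \int[lebesgue2]_(z in D) (h (J j) z)%:E)%E.
  under eq_integral do rewrite EFinM.
  rewrite ge0_integralZl//; first exact/measurable_EFinP/measurable_funTS.
  by move=> z _; rewrite lee_fin.
rewrite ih subrr => H.
have S1 : (\sum_(k < N) \int[lebesgue2]_(z in D) (g k z)%:E <= (b / 4)%:E)%E.
  apply: le_trans (_ : \sum_(k < N) e%:E <= _)%E.
    apply: lee_sum => k _; rewrite /g; case: eqP => [_|/eqP kJ].
      by rewrite integral0 lee_fin ltW.
    (* For k <> J j the cube is shifted by a nonzero multiple of [L], hence into the range of
       [integral_stft_tail]. *)
    rewrite ih; apply/ltW/LP.
    rewrite !PoszM -mulrBl abszM absz_nat leq_pmull//.
    by rewrite absz_gt0 subr_eq0 eqz_nat eq_sym.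
  rewrite sumEFin lee_fin sumr_const card_ord -(mulr_natr e N) /e -mulrA.
  have b40 : 0 <= b / 4 by rewrite divr_ge0// ltW.
  rewrite ler_piMr//.
  by rewrite mulrC ler_pdivrMr ?ltr0n// mul1r ler_nat.
(* The main term is at least b / 2 and the others take away at most b / 4, which leaves the claimed
   b / 4. *)
have : ((2^-1 * b)%:E <= \int[lebesgue2]_(z in D) (cabs (W z))%:E + (b / 4)%:E)%E.
  apply: le_trans (le_trans H (leeD2l _ S1)).
  by rewrite EFinM lee_wpmul2l.
case: (\int[lebesgue2]_(z in D) _)%E => [y||]//; rewrite ?leey// -EFinD !lee_fin.
by lra.
Qed.

End stft_lower_bound.

(** * Upper bounds for amalgam norms *)

Section wiener_upper_bounds.
Context {R : realType} {n : nat}.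
Local Notation V := 'rV[R]_n.+1.
Local Notation C := R[i].
Local Notation cabs := (@ComplexField.Normc.normc R).
Implicit Types f : V -> C.

(** Uniform in p: a unit cube has measure one, so that a pointwise bound controls every L^p norm.
    The weights sum to at most 4^(n + 1). *)
Lemma wiener_norm_le_bounded f (p : \bar R) (r B : R) : (1 <= p)%E -> 1 <= r ->
  schwartz f -> 0 <= B -> (forall k t, cube k t -> cabs (f t) <= B * cube_weight k) ->
  (wiener_norm p r%:E f <= (B * (4 ^+ n.+1) `^ r^-1)%:E)%E.
Proof.
move=> p1 r1 Sf B0 fB; apply: (@amalgam_norm_le _ _ _ _ _ _ _ _ _ r1 cube_weight) => //.
- exact: cube_weight01.
- move=> k; have /andP[w0 _] := @cube_weight01 R n.+1 k.
  apply: (@Lnorm_le_bounded _ _ _ _ _ (measurable_cube k) (lebesgue_cube k)) => //.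
  + by rewrite mulr_ge0.
  + exact: schwartz_measurable.
  + by move=> t kt; rewrite ger0_norm ?cabs_ge0// fB.
- exact: sum_cube_weight.
Qed.

(** The modulated function has modulus |f| times the Fejer kernel [kappa], which is at most [N] and
    has mean at most 1 on every cube; [Lnorm_le_weighted] turns this into N^(1 - 1/p). *)
Lemma wiener_norm_le_fejer f (p r B : R) N L : 1 <= p -> 1 <= r -> (0 < N)%N ->
  (0 < L)%N -> schwartz f -> 0 <= B ->
  (forall k t, cube k t -> cabs (f t) <= B * cube_weight k) ->
  (wiener_norm p%:E r%:E (modulate (N + N) (fejer_coef N) L ord0 f) <=
    (B * N%:R `^ (1 - p^-1) * (4 ^+ n.+1) `^ r^-1)%:E)%E.
Proof.
move=> p1 r1 N0 L0 Sf B0 fB.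
pose kappa (t : V) := N%:R^-1 * cabs (dirichlet N (L%:R * t ord0 ord0)) ^+ 2.
have N0' : 0 < N%:R :> R by rewrite ltr0n.
have kappa_le t : 0 <= kappa t <= N%:R.
  rewrite /kappa mulr_ge0 ?sqr_ge0 ?invr_ge0//=.
  rewrite mulrC ler_pdivrMr// expr2 ler_pM ?cabs_ge0//; exact: cabs_dirichlet_le.
have fE t : cabs (modulate (N + N) (fejer_coef N) L ord0 f t) = cabs (f t) * kappa t.
  rewrite /modulate fejer_trig_poly !ComplexField.Normc.normcM cabs_real.
  by rewrite ger0_norm ?invr_ge0.
apply: (@amalgam_norm_le _ _ _ _ _ _ _ _ _ r1 cube_weight) => //.
- by rewrite mulr_ge0// powR_ge0.
- exact: cube_weight01.
- move=> k; have /andP[w0 _] := @cube_weight01 R n.+1 k.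
  rewrite mulrAC.
  apply: (@Lnorm_le_weighted _ _ _ _ _ (measurable_cube k) _ kappa) => //.
  + by rewrite mulr_ge0.
  + by apply: schwartz_measurable; exact: modulate_schwartz.
  + exact: (measurableT_comp (measurable_fejer N L) (measurable_rV_coord ord0)).
  + exact: integral_fejer_cube.
  + move=> t kt; rewrite ger0_norm ?cabs_ge0// fE ler_wpM2r ?fB//.
    by have /andP[] := kappa_le t.
- exact: sum_cube_weight.
Qed.

End wiener_upper_bounds.

(** * Comparison of exponents and conclusion *)

Lemma powR_growth {R : realType} (a b c K : R) : 0 < c ->
  (forall N : nat, (2 ^ N)%:R `^ a * c <= K * (2 ^ N)%:R `^ b) -> a <= b.
Proof.
move=> c0 H; rewrite leNgt; apply/negP => ba.
have s0 : 0 < a - b by rewrite subr_gt0.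
have K0 : 0 <= K.
  have := H 0%N; rewrite expn0 !powR1 mul1r mulr1; apply: le_trans; exact: ltW.
(* If a > b, then (2^N)^(a - b) <= K / c for all N; [x] is the value that 2^N could then never
   exceed. *)
pose x := (K / c) `^ (a - b)^-1.
pose N := (Num.truncn x).+1.
have xN : x < (2 ^ N)%:R.
  by apply: lt_le_trans (truncnS_gt _) _; rewrite ler_nat ltnW// ltn_expl.
have n0 : 0 < (2 ^ N)%:R :> R by rewrite ltr0n expn_gt0.
have : (2 ^ N)%:R `^ (a - b) <= K / c.
  rewrite ler_pdivlMr// -(ler_pM2r (powR_gt0 b n0)) mulrAC -powRD; last first.
    by apply/implyP => _; rewrite gt_eqF.
  by rewrite subrK H.
have i0 : 0 <= (a - b)^-1 by rewrite invr_ge0 ltW.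
have Kc0 : 0 <= K / c by rewrite divr_ge0// ltW.
move=> H1; have : (2 ^ N)%:R `^ (a - b) `^ (a - b)^-1 <= x.
  by apply: ge0_ler_powR; rewrite ?nnegrE ?powR_ge0.
rewrite -powRrM mulfV ?gt_eqF// powRr1; last exact: ltW.
by rewrite leNgt xN.
Qed.

Lemma hoelder_conjugate_le {R : realType} (p q : R) : 1 <= p -> 1 <= q ->
  q^-1 <= 1 - p^-1 -> (hoelder_conjugate q%:E <= p%:E)%E.
Proof.
move=> p1 q1 H.
have p0 : 0 < p by exact: lt_le_trans p1.
have q0 : 0 < q by exact: lt_le_trans q1.
have ip : 0 < p^-1 by rewrite invr_gt0.
(* [p] is finite, so 1 - 1/p < 1 and q = 1 is excluded. *)
have q1' : 1 < q.
  rewrite -invf_lt1//; apply: le_lt_trans H _; lra.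
rewrite /hoelder_conjugate /= eqe gt_eqF// -EFinD inver subr_eq0 gt_eqF//.
rewrite -EFinM lee_fin ler_pdivrMr ?subr_gt0//.
have : (p * q) * q^-1 <= (p * q) * (1 - p^-1).
  by rewrite ler_wpM2l// mulr_ge0// ltW.
rewrite mulfK ?gt_eqF// mulrBr mulr1 (mulrC p) mulfK ?gt_eqF//.
lra.
Qed.

Theorem proposition3p5 (R : realType) (d : nat) (d_ge1 : (1 <= d)%N)
  (gamma : 'rV[R]_d -> R[i]) (gammaS : schwartz gamma)
  (gamma_neq0 : exists t, gamma t <> 0)
  (g : ('rV[R]_d -> R[i]) -> R[i]) (gM1 : modulation_space1 gamma g)
  (g_neq0 : exists2 phi, schwartz phi & g phi <> 0)
  (p q : \bar R) (p_ge1 : (1 <= p)%E) (q_ge1 : (1 <= q)%E)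
  (C : R) (C_gt0 : 0 < C)
  (estimate : forall f : 'rV[R]_d -> R[i], schwartz f ->
    (wiener_norm2 p q (stft_distribution g f) <= C%:E * wiener_norm p q f)%E) :
  (hoelder_conjugate q <= p)%E /\ (2%:E <= q)%E.
Proof.
(* For q = +oo the conjugate exponent is 1, and both claims are immediate. *)
case: q q_ge1 estimate => [r||]// q_ge1 estimate; last by rewrite leey.
have r1 : 1 <= r by rewrite -lee_fin.
case: d d_ge1 gamma gammaS gamma_neq0 g gM1 g_neq0 estimate =>
  // n _ gamma gammaS gamma_neq0 g [tg _] [psi Spsi gpsi] estimate.
(* The conjugate makes [tf_shift phi 0 0] equal to [psi], so that V_g phi(0, 0) is the conjugate of
   g(psi). *)
pose phi t := (psi t)^*%C.
have Sphi : schwartz phi by exact: schwartz_conj.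
have F0 : stft_distribution g phi (0, 0) <> 0.
  rewrite -[stft_distribution _ _ _]/((g (tf_shift phi 0 0))^*%C).
  have -> : tf_shift phi 0 0 = psi.
    apply/funext => s; rewrite /tf_shift addr0 /phi conjcK.
    rewrite /dot big1 ?mulr0 ?cis0 ?mulr1// => i _.
    by rewrite mxE mul0r.
  by move/eqP; rewrite conjc_eq0 => /eqP.
have [A A0 phiA] := schwartz_cube_weight Sphi.
have Foo : (wiener_norm2 p r%:E (stft_distribution g phi) < +oo)%E.
  apply: le_lt_trans (estimate _ Sphi) _.
  apply: le_lt_trans (lee_wpmul2l _ (wiener_norm_le_bounded p_ge1 r1 Sphi A0 phiA)) _.
    by rewrite lee_fin ltW.
  by rewrite -EFinM ltry.
have [b b0 low] := wiener_norm2_stft_modulate tg p_ge1 r1 Sphi F0 Foo.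
set G := (4 ^+ n.+1) `^ r^-1 in Foo *.
split; last first.
  rewrite lee_fin -(@lef_pV2 _ r 2) ?posrE//; last exact: lt_le_trans r1.
  (* All 2^N coefficients have modulus 1, so every index counts on the left, while the right side
     grows like (2^N)^(1/2). *)
  apply: (@powR_growth _ _ _ b (C * (A * Num.sqrt 2 * G))) => // N.
  have [c [c1 cB]] := @rudin_shapiro R N.
  have [|L L0 lowL] := low (2 ^ N)%N c; first by move=> k; rewrite c1.
  set f := modulate (2 ^ N) c L ord0 phi in lowL.
  have Sf : schwartz f by exact: modulate_schwartz.
  have B0 : 0 <= A * Num.sqrt (2 * 2 ^+ N) by rewrite mulr_ge0.
  have fB k t : cube k t -> ComplexField.Normc.normc (f t) <= A * Num.sqrt (2 * 2 ^+ N) * cube_weight k.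
    move=> kt; rewrite mulrAC /f /modulate ComplexField.Normc.normcM.
    by rewrite ler_pM ?cabs_ge0// phiA.
  rewrite -lee_fin; apply: le_trans (lowL _ id _ _) _ => //.
    by move=> j; rewrite c1 invf_le1// ler1n.
  apply: le_trans (estimate _ Sf) _.
  apply: le_trans (lee_wpmul2l _ (wiener_norm_le_bounded p_ge1 r1 Sf B0 fB)) _.
    by rewrite lee_fin ltW.
  rewrite -EFinM lee_fin sqrtrM// powR12_sqrt// natrX le_eqVlt; apply/orP; left.
  by apply/eqP; rewrite -/G; ring.
case: p p_ge1 estimate low Foo => [s||]// p_ge1 estimate low Foo; last by rewrite leey.
have s1 : 1 <= s by rewrite -lee_fin.
apply: hoelder_conjugate_le => //.
apply: (@powR_growth _ _ _ b (C * (A * 2 `^ (1 - s^-1) * G))) => // N.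
(* Of the kernel of order K = 2 M only the coefficients of index M + j, j < M, are kept: these are
   at least 1/2 and number 2^N. The factor 2^(1 - 1/s) in the constant comes from K^(1 - 1/s). *)
pose M := (2 ^ N)%N; pose K := (M + M)%N.
have M0 : (0 < M)%N by rewrite expn_gt0.
have K0 : (0 < K)%N by rewrite addn_gt0 M0.
have [|L L0 lowL] := low (K + K)%N (fejer_coef K).
  by move=> k; rewrite ger0_norm ?fejer_coef_ge0 ?fejer_coef_le1.
have MK (j : 'I_M) : (M + j < K + K)%N.
  by apply: leq_trans (leq_addr K K); rewrite ltn_add2l.
set f := modulate _ _ _ _ _ in lowL.
have Sf : schwartz f by exact: modulate_schwartz.
rewrite -lee_fin; apply: le_trans (lowL M (fun j => Ordinal (MK j)) _ _) _.
- by move=> i j /(congr1 val) /= /addnI ij; exact: val_inj.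
- move=> j /=; rewrite ger0_norm ?fejer_coef_ge0// fejer_coef_ge// ?ltn_add2l//.
  by rewrite doubleD -addnn leq_addr.
apply: le_trans (estimate _ Sf) _.
apply: le_trans (lee_wpmul2l _ (wiener_norm_le_fejer s1 r1 K0 L0 Sphi A0 phiA)) _.
  by rewrite lee_fin ltW.
rewrite -EFinM lee_fin /K addnn -mul2n natrM powRM// le_eqVlt; apply/orP; left.
by apply/eqP; rewrite -/G; ring.
Qed.
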